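(* Let $(\mathcal A,\varphi)$ be a $\mathbb C$-valued noncommutative probability space (with $\mathcal A$ and $\varphi$ unital in (i) and (ii)). (i) The cumulants $K_\pi^{\mathrm T}$ associated with the tensor spreadability system satisfy $K_\pi^{\mathrm T}=K_{(\pi)}^{\mathrm T}$ for all $\pi\in\mathcal{OP}_n$. (ii) The cumulants $K_\pi^{\mathrm F}$ associated with the free spreadability system satisfy $K^{\mathrm F}_\pi=K^{\mathrm F}_{(\pi)}$ for $\pi\in\mathcal{ONC}_n$ and $K^{\mathrm F}_\pi=0$ for $\pi\in\mathcal{OP}_n\setminus\mathcal{ONC}_n$. (iii) The cumulants $K_\pi^{\mathrm B}$ associated with the Boolean spreadability system satisfy $K^{\mathrm B}_\pi=K^{\mathrm B}_{(\pi)}$ for $\pi\in\mathcal{OI}_n$ and $K^{\mathrm B}_\pi=0$ for $\pi\in\mathcal{OP}_n\setminus\mathcal{OI}_n$. (iv) The cumulants $K_\pi^{\mathrm M}$ associated with the monotone spreadability system satisfy $K^{\mathrm M}_\pi=K^{\mathrm M}_{(\pi)}$ for $\pi\in\mathcal M_n$ and $K^{\mathrm M}_\pi=0$ for $\pi\in\mathcal{OP}_n\setminus\mathcal M_n$.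
   Context: Ordered set partitions. $\mathbb N=\{1,2,\dots\}$, $[n]=\{1,\dots,n\}$. An ordered set partition of $[n]$ is a sequence $\pi=(P_1,\dots,P_p)$ of pairwise disjoint nonempty blocks with union $[n]$; $\mathcal{OP}_n$ is the set of them; $\pi(i)$ is the index $k$ with $i\in P_k$; $\hat1_n=([n])$. The quasi-meet is $\pi\curlywedge\sigma=(P_1\cap S_1,P_1\cap S_2,\dots,P_1\cap S_s,P_2\cap S_1,\dots,P_p\cap S_s)$ (empty sets removed) for $\sigma=(S_1,\dots,S_s)$. The ordered kernel $\kappa(i_1,\dots,i_n)$ has as blocks the level sets $\{k:i_k=v\}$ listed in increasing order of $v$. A (set or ordered set) partition is noncrossing if there are no $i<j<k<l$ with $i,k$ in one block and $j,l$ in a different block; $\mathcal{ONC}_n$ is the set of noncrossing ordered set partitions. $\mathcal{OI}_n$ is the set of $\pi\in\mathcal{OP}_n$ all of whose blocks are intervals of $[n]$. Two blocks $B,B'$ of a noncrossing partition form a nesting with outer block $B$ and inner block $B'$ if there are $i,j\in B$ with $i<k<j$ for all $k\in B'$. $\mathcal M_n$ (monotone partitions) is the set of $\pi\in\mathcal{ONC}_n$ such that in every nesting the outer block precedes the inner block in the order of $\pi$. Spreadability systems and cumulants. A $\mathbb C$-valued noncommutative probability space is an algebra $\mathcal A$ over $\mathbb C$ with a linear functional $\varphi$. A spreadability system for it is a triple $(\mathcal U,\tilde\varphi,(\iota^{(i)})_{i\ge1})$ with $\mathcal U$ an algebra, $\tilde\varphi:\mathcal U\to\mathbb C$ linear,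 $\iota^{(i)}:\mathcal A\to\mathcal U$ homomorphisms with $\tilde\varphi\circ\iota^{(i)}=\varphi$ such that, with $X^{(i)}=\iota^{(i)}(X)$, the value $\tilde\varphi(X_1^{(i_1)}\cdots X_n^{(i_n)})$ depends on $(i_1,\dots,i_n)$ only through $\pi=\kappa(i_1,\dots,i_n)$; this value is denoted $\varphi_\pi(X_1,\dots,X_n)$. Put $\varphi_\pi(M_1.X_1,\dots,M_n.X_n)=\sum_{i_1=1}^{M_1}\cdots\sum_{i_n=1}^{M_n}\varphi_{\pi\curlywedge\kappa(i_1,\dots,i_n)}(X_1,\dots,X_n)$. For $\pi$ with $p$ blocks, $\varphi_\pi(N_{\pi(1)}.X_1,\dots,N_{\pi(n)}.X_n)$ is a polynomial in $N_1,\dots,N_p$, and the cumulant $K_\pi(X_1,\dots,X_n)$ is its coefficient of $N_1\cdots N_p$. $K_n=K_{\hat1_n}$ and $K_{(\pi)}(X_1,\dots,X_n)=\prod_{P\in\pi}K_{|P|}(X_{p_1},\dots,X_{p_k})$ where $P=\{p_1<\dots<p_k\}$. The systems. Tensor ($\mathcal A,\varphi$ unital): $\mathcal U=\bigotimes_{i=1}^\infty\mathcal A$ (algebraic), $\tilde\varphi=\bigotimes_{i=1}^\infty\varphi$, $\iota^{(j)}(X)=1^{\otimes(j-1)}\otimes X\otimes1\otimes\cdots$. Free ($\mathcal A,\varphi$ unital): $\mathcal U$ the unital free product of countably many copies of $\mathcal A$, $\iota^{(i)}$ the embedding as $i$th copy, $\tilde\varphi$ the free product functional, i.e. the unital linear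 functional with $\tilde\varphi\circ\iota^{(i)}=\varphi$ and $\tilde\varphi(X_1^{(i_1)}\cdots X_n^{(i_n)})=0$ whenever $i_k\ne i_{k+1}$ for all $k$ and $\varphi(X_k)=0$ for all $k$. Boolean: $\mathcal U$ the nonunital free product (coproduct of algebras) of countably many copies of $\mathcal A$, $\iota^{(i)}$ the $i$th embedding, $\tilde\varphi(X_1^{(i_1)}\cdots X_n^{(i_n)})=\varphi(X_1)\cdots\varphi(X_n)$ whenever $i_k\ne i_{k+1}$ for $1\le k\le n-1$. Monotone: $\mathcal U,\iota^{(i)}$ as in the Boolean case, $\tilde\varphi$ determined recursively by: $\tilde\varphi(X_1^{(i_1)})=\varphi(X_1)$; for $n\ge2$ and $i_1>i_2$, $\tilde\varphi(X_1^{(i_1)}\cdots X_n^{(i_n)})=\varphi(X_1)\tilde\varphi(X_2^{(i_2)}\cdots X_n^{(i_n)})$; for $n\ge2$ and $i_n>i_{n-1}$, $\tilde\varphi(X_1^{(i_1)}\cdots X_n^{(i_n)})=\tilde\varphi(X_1^{(i_1)}\cdots X_{n-1}^{(i_{n-1})})\varphi(X_n)$; for $n\ge3$, $2\le j\le n-1$ and $i_{j-1}<i_j>i_{j+1}$, $\tilde\varphi(X_1^{(i_1)}\cdots X_n^{(i_n)})=\tilde\varphi(X_1^{(i_1)}\cdots X_{j-1}^{(i_{j-1})}X_{j+1}^{(i_{j+1})}\cdots X_n^{(i_n)})\varphi(X_j)$. *)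

(* Defs.v *)
From HB Require Import structures.
From mathcomp Require Import all_boot all_order all_algebra.
From mathcomp Require Import mpoly complex.
From mathcomp Require Import reals.
From mathcomp Require classical_sets.

Set Implicit Arguments.
Unset Strict Implicit.
Unset Printing Implicit Defensive.

Import Order.TTheory GRing.Theory Num.Theory.
Local Open Scope ring_scope.

(* Conventions: [n] is 'I_n and the copies of an algebra are indexed by
   i : nat, so all indices start at 0 instead of 1. *)

Section OrderedSetPartitions.
Local Open Scope nat_scope.

Definition is_osp n (s : seq {set 'I_n}) : bool :=
  [&& all (fun B : {set 'I_n} => B != set0) s,
      pairwise (fun B B' : {set 'I_n} => [disjoint B & B']) s &
      \bigcup_(B <- s) B == [set: 'I_n]].

Record osp n := OSP {blocks : seq {set 'I_n}; _ : is_osp blocks}.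

HB.instance Definition _ n := [isSub for @blocks n].
HB.instance Definition _ n := [Equality of osp n by <:].

Definition drop_empty n (s : seq {set 'I_n}) : seq {set 'I_n} :=
  [seq B <- s | B != set0].

Lemma drop_empty_osp n (s : seq {set 'I_n}) :
  pairwise (fun B B' : {set 'I_n} => [disjoint B & B']) s ->
  (forall k : 'I_n, exists2 B, B \in s & k \in B) ->
  is_osp (drop_empty s).
Proof.
move=> dis cov; apply/and3P; split; first exact: filter_all.
  by apply: subseq_pairwise dis; exact: filter_subseq.
apply/eqP/setP=> k; rewrite in_setT; have [B Bs kB] := cov k.
rewrite (bigcup_seq) /=; apply/bigcupP; exists B => //.
by rewrite mem_filter Bs andbT; apply/set0Pn; exists k.
Qed.

Fact one_osp_subproof n : is_osp (drop_empty [:: [set: 'I_n]]).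
Proof. by apply: drop_empty_osp => // k; exists setT; rewrite ?inE. Qed.

(* The partition ([n]); it is the empty sequence when n = 0. *)
Definition one_osp n : osp n := OSP (one_osp_subproof n).

Lemma osp_cover n (pi : osp n) (k : 'I_n) :
  exists2 B, B \in blocks pi & k \in B.
Proof.
case: pi => s /= /and3P[_ _ /eqP cov].
have : k \in \bigcup_(B <- s) B by rewrite cov in_setT.
by rewrite bigcup_seq => /bigcupP[B Bs kB]; exists B.
Qed.

Lemma osp_disjoint n (pi : osp n) :
  pairwise (fun B B' : {set 'I_n} => [disjoint B & B']) (blocks pi).
Proof. by case: pi => s /= /and3P[]. Qed.

Lemma osp_neq0 n (pi : osp n) B : B \in blocks pi -> B != set0.
Proof. by case: pi => s /= /and3P[/allP s0 _ _]; exact: s0. Qed.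

Fact qmeet_subproof n (pi sigma : osp n) :
  is_osp (drop_empty [seq P :&: Q | P <- blocks pi, Q <- blocks sigma]).
Proof.
apply: drop_empty_osp; last first.
  move=> k; have [P Ppi kP] := osp_cover pi k.
  have [Q Qsi kQ] := osp_cover sigma k.
  by exists (P :&: Q); [exact: allpairs_f | rewrite inE kP].
have := osp_disjoint pi; have := osp_disjoint sigma.
elim: (blocks pi) => //= P s IHs dsi /andP[/allP dP ds].
rewrite pairwise_cat IHs // andbT pairwise_map; apply/andP; split.
  apply/allrelP => _ _ /mapP[Q _ ->] /allpairsP[[P' Q'] /= [P's _ ->]].
  by apply: disjointW (dP _ P's); exact: subsetIl.
by apply: sub_pairwise dsi => Q Q'; apply: disjointW; exact: subsetIr.
Qed.

Definition qmeet n (pi sigma : osp n) : osp n :=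
  OSP (qmeet_subproof pi sigma).

Fact okernel_subproof n (i : 'I_n -> nat) :
  is_osp (drop_empty [seq [set k | i k == v] | v <- sort leq (undup (codom i))]).
Proof.
apply: drop_empty_osp; last first.
  move=> k; exists [set l | i l == i k]; rewrite ?inE //.
  by apply/map_f; rewrite mem_sort mem_undup codom_f.
rewrite pairwise_map.
have := undup_uniq (codom i); rewrite -(sort_uniq leq) uniq_pairwise.
apply: sub_pairwise => v w /= vw; rewrite -setI_eq0; apply/eqP/setP => k.
by rewrite !inE; apply/andP => -[/eqP-> /eqP]; apply/eqP.
Qed.

Definition okernel n (i : 'I_n -> nat) : osp n := OSP (okernel_subproof i).

(* The function pi(k), with values starting at 0. *)
Definition block_index n (pi : osp n) (k : 'I_n) : nat :=
  find (fun B : {set 'I_n} => k \in B) (blocks pi).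

Lemma block_index_nth n (pi : osp n) (v : nat) (k : 'I_n) :
  v < size (blocks pi) ->
  (block_index pi k == v) = (k \in nth set0 (blocks pi) v).
Proof.
move=> vs; have hk : has (fun B : {set 'I_n} => k \in B) (blocks pi).
  by apply/hasP; have [B Bs kB] := osp_cover pi k; exists B.
apply/eqP/idP => [<-|kv]; first exact: (nth_find set0 hk).
apply/eqP; rewrite /block_index; have := nth_find set0 hk.
have := hk; rewrite has_find; set u := find _ _ => us ku.
have /pairwiseP - /(_ set0) dis := osp_disjoint pi.
have no (a b : nat) : a < size (blocks pi) -> b < size (blocks pi) -> a < b ->
    k \in nth set0 (blocks pi) a -> k \in nth set0 (blocks pi) b -> False.
  move=> sa sb ab ka kb; have := dis a b sa sb ab.
  by move/disjointFr => /(_ _ ka); rewrite kb.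
by case: (ltngtP u v) => // uv; [case: (no u v) | case: (no v u)].
Qed.

Lemma okernel_block_index n (pi : osp n) : okernel (block_index pi) = pi.
Proof.
apply: val_inj => /=; set s := sort _ _.
have -> : s = iota 0 (size (blocks pi)).
  apply: (irr_sorted_eq ltn_trans ltnn); rewrite ?iota_ltn_sorted //.
    rewrite ltn_sorted_uniq_leq sort_uniq undup_uniq.
    exact: sort_sorted leq_total _.
  move=> v; rewrite mem_sort mem_undup mem_iota /= add0n.
  apply/codomP/idP => [[k ->]|vs].
    rewrite -has_find; apply/hasP.
    by have [B Bs kB] := osp_cover pi k; exists B.
  have /set0Pn[k kv] : nth set0 (blocks pi) v != set0.
    by apply: osp_neq0; exact: mem_nth.
  by exists k; apply/esym/eqP; rewrite block_index_nth.
transitivity (drop_empty (blocks pi)); last first.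
  by case: (pi) => t /= /and3P[/all_filterP].
congr drop_empty; apply: (@eq_from_nth _ set0) => [|v].
  by rewrite size_map size_iota.
rewrite size_map size_iota => vs.
rewrite (nth_map 0) ?size_iota // nth_iota //.
by apply/setP => k; rewrite inE add0n block_index_nth.
Qed.

Definition noncrossing n (pi : osp n) : Prop :=
  ~ exists B B' : {set 'I_n}, exists i j k l : 'I_n,
      [/\ B \in blocks pi, B' \in blocks pi & B != B'] /\
      [/\ i < j, j < k & k < l] /\
      [/\ i \in B, k \in B, j \in B' & l \in B'].

Definition is_interval n (B : {set 'I_n}) : Prop :=
  forall i j k : 'I_n, i \in B -> k \in B -> i < j < k -> j \in B.

Definition interval_osp n (pi : osp n) : Prop :=
  forall B, B \in blocks pi -> is_interval B.

Definition nesting n (outer inner : {set 'I_n}) : Prop :=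
  exists i j : 'I_n,
    [/\ i \in outer, j \in outer & forall k, k \in inner -> i < k < j].

Definition monotone_osp n (pi : osp n) : Prop :=
  noncrossing pi /\
  forall B B' : {set 'I_n}, B \in blocks pi -> B' \in blocks pi ->
    nesting B B' -> index B (blocks pi) < index B' (blocks pi).

End OrderedSetPartitions.

HB.mixin Record Lmodule_isNuAlgebra (C : numFieldType) (A : Type)
    of GRing.Lmodule C A := {
  numul : A -> A -> A;
  numulA : associative numul;
  numulDl : forall x y z : A, numul (x + y) z = numul x z + numul y z;
  numulDr : forall x y z : A, numul x (y + z) = numul x y + numul x z;
  numulZl : forall (c : C) (x y : A), numul (c *: x) y = c *: numul x y;
  numulZr : forall (c : C) (x y : A), numul x (c *: y) = c *: numul x y }.

#[short(type="nuAlgType")]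
HB.structure Definition NuAlgebra (C : numFieldType) :=
  {A of Lmodule_isNuAlgebra C A & GRing.Lmodule C A}.

#[non_forgetful_inheritance]
HB.instance Definition _ (C : numFieldType) (A : algType C) :=
  Lmodule_isNuAlgebra.Build C A (@mulrA A) (@mulrDl A) (@mulrDr A)
    (fun c x y => esym (scalerAl c x y)) (fun c x y => esym (scalerAr c x y)).

Definition nuprod (C : numFieldType) (A : nuAlgType C) (s : seq A) : A :=
  if s is x :: s' then foldl numul x s' else 0.

Definition nu_multiplicative (C : numFieldType) (A B : nuAlgType C)
    (f : A -> B) : Prop :=
  forall x y : A, f (numul x y) = numul (f x) (f y).

(* The product X_1^(i_1) ... X_n^(i_n) for w = [:: (i_1, X_1); ...; (i_n, X_n)];
   it is only meaningful for nonempty w. *)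
Definition word (C : numFieldType) (A U : nuAlgType C) (iota : nat -> A -> U)
    (w : seq (nat * A)) : U :=
  nuprod [seq iota p.1 p.2 | p <- w].

Definition labelled (A : Type) n (i : 'I_n -> nat) (X : 'I_n -> A) :
    seq (nat * A) :=
  [seq (i k, X k) | k : 'I_n].

Record spreadability_system (C : numFieldType) (A U : nuAlgType C)
    (phi : {scalar A}) := SpreadabilitySystem {
  ss_phi : {scalar U};
  ss_iota : nat -> {linear A -> U};
  ss_iotaM : forall i, nu_multiplicative (ss_iota i);
  ss_phi_iota : forall i a, ss_phi (ss_iota i a) = phi a;
  ss_spreadable : forall n (X : 'I_n -> A) (i j : 'I_n -> nat),
    okernel i = okernel j ->
    ss_phi (word ss_iota (labelled i X)) = ss_phi (word ss_iota (labelled j X)) }.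

Section Cumulants.
Variables (C : numFieldType) (A U : nuAlgType C) (phi : {scalar A}).
Variable S : spreadability_system U phi.

(* By [okernel_block_index] and [ss_spreadable], the choice of the index
   function with kernel pi is immaterial. *)
Definition phi_osp n (pi : osp n) (X : 'I_n -> A) : C :=
  ss_phi S (word (ss_iota S) (labelled (block_index pi) X)).

Definition phi_dot n (pi : osp n) (M : 'I_n -> nat) (X : 'I_n -> A) : C :=
  \sum_(i : {dffun forall k : 'I_n, 'I_(M k)})
    phi_osp (qmeet pi (okernel (fun k => i k : nat))) X.

Definition is_dot_poly n (pi : osp n) (X : 'I_n -> A)
    (P : {mpoly C[size (blocks pi)]}) : Prop :=
  forall N : nat -> nat, (forall b, 0 < N b)%N ->
    phi_dot pi (fun k => N (block_index pi k)) X = P.@[fun b => (N b)%:R].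

(* Such a polynomial exists and is unique for n > 0. *)
Definition dot_poly n (pi : osp n) (X : 'I_n -> A) :
    {mpoly C[size (blocks pi)]} :=
  classical_sets.xget 0 (is_dot_poly X).

Definition cumulant n (pi : osp n) (X : 'I_n -> A) : C :=
  (dot_poly pi X)@_[multinom 1%N | _ < size (blocks pi)].

(* [enum_val] lists the elements of P in increasing order. *)
Definition block_cumulant n (pi : osp n) (X : 'I_n -> A) : C :=
  \prod_(P <- blocks pi) cumulant (one_osp #|P|) (fun j : 'I_#|P| => X (enum_val j)).

End Cumulants.

Definition upd (A : Type) (x : nat -> A) (j : nat) (a : A) : nat -> A :=
  fun k => if k == j then a else x k.

Definition finitely_supported (C : numFieldType) (A : algType C)
    (x : nat -> A) : Prop :=
  exists n, forall j, (n <= j)%N -> x j = 1.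

Definition multilinear (C : numFieldType) (A : algType C) (V : lmodType C)
    (f : (nat -> A) -> V) : Prop :=
  forall x : nat -> A, finitely_supported x ->
  forall (j : nat) (c : C) (a b : A),
    f (upd x j (c *: a + b)) = c *: f (upd x j a) + f (upd x j b).

(* U is the algebraic tensor product of countably many copies of A, where
   t x is the elementary tensor x 0 (x) x 1 (x) ... with almost all x j = 1;
   the values of t at other families are irrelevant. *)
Definition is_infinite_tensor (C : numFieldType) (A U : algType C)
    (t : (nat -> A) -> U) : Prop :=
  [/\ multilinear t,
      forall (V : lmodType C) (f : (nat -> A) -> V), multilinear f ->
        exists g : {linear U -> V},
          (forall x, finitely_supported x -> g (t x) = f x) /\
          forall g' : {linear U -> V},
            (forall x, finitely_supported x -> g' (t x) = f x) -> g' =1 g,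
      t (fun=> 1) = 1 &
      forall x y, finitely_supported x -> finitely_supported y ->
        t (fun j => x j * y j) = t x * t y].

Definition tensor_system (C : numFieldType) (A U : algType C)
    (phi : {scalar A}) (S : spreadability_system U phi) : Prop :=
  exists t : (nat -> A) -> U,
    [/\ is_infinite_tensor t,
        forall j a, ss_iota S j a = t (upd (fun=> 1) j a) &
        forall (x : nat -> A) (n : nat), (forall j, (n <= j)%N -> x j = 1) ->
          ss_phi S (t x) = \prod_(j < n) phi (x j)].

Definition is_unital_free_product (C : numFieldType) (A U : algType C)
    (iota : nat -> A -> U) : Prop :=
  (forall i, iota i 1 = 1) /\
  forall (B : algType C) (f : nat -> {lrmorphism A -> B}),
    exists g : {lrmorphism U -> B},
      (forall i a, g (iota i a) = f i a) /\
      forall g' : {lrmorphism U -> B},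
        (forall i a, g' (iota i a) = f i a) -> g' =1 g.

Definition alternating (A : Type) (w : seq (nat * A)) : bool :=
  sorted (fun p q => p.1 != q.1) w.

Definition free_system (C : numFieldType) (A U : algType C)
    (phi : {scalar A}) (S : spreadability_system U phi) : Prop :=
  [/\ is_unital_free_product (ss_iota S),
      ss_phi S 1 = 1 &
      forall w : seq (nat * A), w != [::] -> alternating w ->
        (forall p, p \in w -> phi p.2 = 0) ->
        ss_phi S (word (ss_iota S) w) = 0].

Definition is_nonunital_free_product (C : numFieldType) (A U : nuAlgType C)
    (iota : nat -> A -> U) : Prop :=
  forall (B : nuAlgType C) (f : nat -> {linear A -> B}),
    (forall i, nu_multiplicative (f i)) ->
    exists g : {linear U -> B},
      [/\ nu_multiplicative g,
          forall i a, g (iota i a) = f i a &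
          forall g' : {linear U -> B}, nu_multiplicative g' ->
            (forall i a, g' (iota i a) = f i a) -> g' =1 g].

Definition boolean_system (C : numFieldType) (A U : nuAlgType C)
    (phi : {scalar A}) (S : spreadability_system U phi) : Prop :=
  is_nonunital_free_product (ss_iota S) /\
  forall w : seq (nat * A), w != [::] -> alternating w ->
    ss_phi S (word (ss_iota S) w) = \prod_(p <- w) phi p.2.

Definition monotone_system (C : numFieldType) (A U : nuAlgType C)
    (phi : {scalar A}) (S : spreadability_system U phi) : Prop :=
  let E w := ss_phi S (word (ss_iota S) w) in
  [/\ is_nonunital_free_product (ss_iota S),
      forall i x, E [:: (i, x)] = phi x,
      forall i j x y w, (i > j)%N ->
        E [:: (i, x), (j, y) & w] = phi x * E ((j, y) :: w),
      forall i j x y w, (i > j)%N ->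
        E (w ++ [:: (j, y); (i, x)]) = E (w ++ [:: (j, y)]) * phi x &
      forall i j k x y z w w', (i < j)%N -> (k < j)%N ->
        E (w ++ [:: (i, x), (j, y), (k, z) & w']) =
        E (w ++ [:: (i, x), (k, z) & w']) * phi y].

(* Main.v *)
Require Import Defs.
From mathcomp Require Import all_boot all_order all_algebra complex reals.
From mathcomp Require Import mpoly qpoly.
From mathcomp Require classical_sets boolp.

(** Each of the four functionals factorizes along suitable sub-words, and this
    factorization survives the summation over the copies that defines the
    polynomials whose multilinear coefficients are the cumulants.

    An ordered set partition pi together with letters X_1, ..., X_n is encoded
    as the word w of the pairs (pi(k), X_k).  Given multiplicities N, the label
    b is expanded into N_b consecutive copies, the copies of distinct labels
    being stacked in increasing order; the sum [dot E N w] of the expectations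
    of all expansions is phi_pi(N_{pi(1)}.X_1, ..., N_{pi(n)}.X_n)
    ([phi_dot_expect]).  It has two properties.  It is polynomial in N
    ([polyfun_dot]): raising N_b by one lets the letters labelled b also choose
    one new copy, so that the difference in N_b is a sum of functions of the
    same kind with fewer letters labelled b.  It vanishes as soon as N_b = 0 for
    some label b of w ([dot_vanishes]).  Hence, if dot w = dot r * dot w' for
    two complementary sub-words r and w' of w, the coefficient of the product
    of the N_b over the labels of w is the product of those of r and w' when r
    and w' share no label, and it is 0 when they share the label b, because the
    product is then divisible by N_b^2 ([wcum_peel], [wcum_eq0]).

    So it suffices to split off one sub-word r with a single label at a time
    ([wcum_factorization]).
    - Tensor: r consists of all letters with a given label.
    - Boolean: r is the initial run of equal labels.  If its label occurs again
      the cumulant is 0 and the block is not an interval.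
    - Monotone: r is the first run of the largest label.  If that label occurs
      again the cumulant is 0 and the last block surrounds an element of an
      earlier one.
    - Free: r is a block that is an interval, if there is one; a nonempty
      noncrossing partition always has one ([noncrossing_contiguous]).  If
      there is none, every label has at least two runs.  The product over the
      runs of the centred elements U_r - phi(U_r), where U_r sums the expansions
      of the run r, has expectation 0.  Removing the centrings one by one
      changes the expectation by products phi(U_r) * h in which both factors
      vanish when N_b = 0, b being the label of r.  These changes do not affect
      the multilinear coefficient, which is therefore 0 ([mlcoef_hybrid],
      [hybrid_alternating]).

    The classes of partitions become conditions on the sequence of labels: no
    pattern x y x for interval partitions, no x y x with y < x for monotone
    ones, and no x y x y for noncrossing ones (x and y distinct). *)

Set Implicit Arguments.
Unset Strict Implicit.
Unset Printing Implicit Defensive.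

Import Order.TTheory GRing.Theory Num.Theory.
Local Open Scope ring_scope.

(** * Functions of multiplicities that are polynomial *)

Section PolynomialFunctions.
Variables (C : numFieldType) (p : nat).

Definition natpt (N : nat -> nat) : 'I_p -> C := fun b => (N b)%:R.

Definition represents (Q : {mpoly C[p]}) (g : (nat -> nat) -> C) : Prop :=
  forall N, g N = Q.@[natpt N].

Definition polyfun (g : (nat -> nat) -> C) : Prop := exists Q, represents Q g.

Lemma base_inj n (d : nat) (m m' : 'I_n -> nat) :
  (forall i, m i < d)%N -> (forall i, m' i < d)%N ->
  (\sum_(i < n) m i * d ^ i = \sum_(i < n) m' i * d ^ i)%N -> m =1 m'.
Proof.
elim: n m m' => [|n IHn] m m' md m'd; first by move=> _ [].
have E (f : 'I_n.+1 -> nat) : (\sum_(i < n.+1) f i * d ^ i =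
    (\sum_(i < n) f (lift ord0 i) * d ^ i) * d + f ord0)%N.
  rewrite big_ord_recl expn0 muln1 addnC big_distrl /=; congr addn.
  by apply: eq_bigr => i _; rewrite /bump /= add1n expnSr mulnA.
rewrite !E => eqs.
have e0 : m ord0 = m' ord0.
  by have := congr1 (modn^~ d) eqs; rewrite /= !modnMDl !modn_small.
have d0 : (0 < d)%N by apply: leq_ltn_trans (md ord0).
have eS : m \o lift ord0 =1 m' \o lift ord0.
  apply: IHn => [i|i|] /=; [exact: md | exact: m'd |].
  by move/eqP: eqs; rewrite e0 eqn_add2r eqn_pmul2r // => /eqP.
by move=> i; have [j ->|->] := unliftP ord0 i; [exact: eS | exact: e0].
Qed.

Lemma poly_nat_eq0 (q : {poly C}) :
  (forall t : nat, (0 < t)%N -> q.[t%:R] = 0) -> q = 0.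
Proof.
move=> q0; apply/eqP; apply: contraT => qn0.
have := max_poly_roots (rs := [seq t.+1%:R : C | t <- iota 0 (size q)]) qn0.
rewrite size_map size_iota ltnn; apply.
  by apply/allP => _ /mapP[t _ ->]; apply/eqP/q0.
by rewrite map_inj_uniq ?iota_uniq // => s t /eqP; rewrite eqr_nat => /eqP[].
Qed.

(** Kronecker substitution: for d larger than all exponents, the substitution
    of t^(d^i) for the i-th variable keeps distinct monomials distinct, so the
    resulting univariate polynomial, which has all positive integers as roots,
    has the same coefficients as P. *)
Lemma mpoly_nat_eq0 (P : {mpoly C[p]}) :
  (forall N : nat -> nat, (forall b, 0 < N b)%N -> P.@[natpt N] = 0) -> P = 0.
Proof.
move=> P0; pose d := msize P.
have md (m : 'X_{1..p}) : m \in msupp P -> forall i, (m i < d)%N.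
  move=> mP i; apply: leq_ltn_trans (msize_mdeg_lt mP).
  by rewrite mdegE (bigD1 i) //= leq_addr.
(* The exponent of the univariate image of the monomial m. *)
pose ex (m : 'X_{1..p}) := (\sum_(i < p) m i * d ^ i)%N.
pose q : {poly C} := \sum_(m <- msupp P) P@_m *: 'X^(ex m).
have q0 : q = 0.
  apply: poly_nat_eq0 => t t0.
  have := P0 (fun b => t ^ (d ^ b))%N (fun b => ltac:(by rewrite expn_gt0 t0)).
  rewrite mevalE => <-; rewrite /q horner_sum; apply: eq_bigr => m _.
  rewrite hornerZ hornerXn; congr (_ * _); rewrite /ex -prodrXr.
  by apply: eq_bigr => i _; rewrite /natpt natrX mulnC exprM.
apply/mpolyP => m; rewrite mcoeff0.
have [mP|/memN_msupp_eq0//] := boolP (m \in msupp P).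
have := congr1 (coefp (ex m)) q0; rewrite /= coef0 => <-.
rewrite /q coef_sum (bigD1_seq m) ?msupp_uniq //= coefZ coefXn eqxx mulr1.
rewrite big1_seq ?addr0 // => m' /andP[m'm m'P].
rewrite coefZ coefXn; case: eqP => [e|]; rewrite ?mulr0 //.
case/eqP: m'm; apply/mnmP; apply: (base_inj (d := d)); try exact: md.
by rewrite -/(ex m') -e.
Qed.

Lemma represents_inj Q Q' g : represents Q g -> represents Q' g -> Q = Q'.
Proof.
move=> Qg Q'g; apply/eqP; rewrite -subr_eq0; apply/eqP/mpoly_nat_eq0 => N _.
by rewrite mevalB -Qg -Q'g subrr.
Qed.

(** The exponent of the product of the N_b over the labels b in L. *)
Definition multilin (L : seq nat) : 'X_{1..p} :=
  [multinom nat_of_bool (nat_of_ord b \in L) | b < p].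

(** The coefficient at [multilin L] of the polynomial that represents g; the
    default value of the choice concerns only functions that are not
    polynomial. *)
Definition mlcoef (L : seq nat) (g : (nat -> nat) -> C) : C :=
  (classical_sets.xget 0 (represents^~ g))@_(multilin L).

Lemma mlcoefE L g Q : represents Q g -> mlcoef L g = Q@_(multilin L).
Proof.
move=> Qg; rewrite /mlcoef; congr (_@_ _).
apply: (represents_inj (g := g)) => //.
exact: (@classical_sets.xgetI _ 0 (represents^~ g) Q Qg).
Qed.

Definition vanishes (g : (nat -> nat) -> C) (b : nat) : Prop :=
  forall N, N b = 0%N -> g N = 0.

(** The monomials of Q free of the variable b sum to the polynomial obtained
    by setting that variable to 0, hence to 0. *)
Lemma vanishes_coef Q g (b : 'I_p) (m : 'X_{1..p}) :
  represents Q g -> vanishes g b -> m b = 0%N -> Q@_m = 0.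
Proof.
move=> Qg gb mb; pose Q' := \sum_(k <- msupp Q | k b == 0%N) Q@_k *: 'X_[k].
have -> : Q@_m = Q'@_m.
  rewrite /Q' raddf_sum /= big_mkcond /=.
  have [mQ|mQ] := boolP (m \in msupp Q).
    rewrite (bigD1_seq m) ?msupp_uniq //= mb eqxx mcoeffZ mcoeffX eqxx mulr1.
    rewrite big1 ?addr0 // => k /negPf km.
    by rewrite mcoeffZ mcoeffX km mulr0 if_same.
  rewrite memN_msupp_eq0 // big1_seq // => k kQ.
  rewrite mcoeffZ mcoeffX; case: (eqVneq k m) => [e|]; rewrite ?mulr0 ?if_same //.
  by move: mQ kQ; rewrite -e andTb => /negPf->.
suff -> : Q' = 0 by rewrite mcoeff0.
apply: mpoly_nat_eq0 => N _; pose N' (l : nat) := if l == b :> nat then 0%N else N l.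
transitivity Q.@[natpt N']; last by rewrite -Qg gb // /N' eqxx.
rewrite [RHS]mevalE /Q' raddf_sum /= big_mkcond; apply: eq_bigr => k _.
case: (posnP (k b)) => [kb|kb].
  rewrite mevalZ mevalX; congr (_ * _); apply: eq_bigr => i _.
  rewrite /natpt /N'; case: (eqVneq (i : nat) b) => [/val_inj ->|//].
  by rewrite kb !expr0.
rewrite (bigD1 b) //= /natpt /N' eqxx expr0n gtn_eqF //=.
by rewrite mul0r mulr0.
Qed.

Lemma polyfunM g h : polyfun g -> polyfun h -> polyfun (fun N => g N * h N).
Proof. by move=> [P Pg] [Q Qh]; exists (P * Q) => N; rewrite mevalM -Pg -Qh. Qed.

Lemma polyfunB g h : polyfun g -> polyfun h -> polyfun (fun N => g N - h N).
Proof. by move=> [P Pg] [Q Qh]; exists (P - Q) => N; rewrite mevalB -Pg -Qh. Qed.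

Lemma eq_polyfun g h : g =1 h -> polyfun g -> polyfun h.
Proof. by move=> gh [P Pg]; exists P => N; rewrite -gh. Qed.

Lemma eq_mlcoef L g h : polyfun g -> g =1 h -> mlcoef L g = mlcoef L h.
Proof.
move=> [P Pg] gh; rewrite (mlcoefE L Pg); apply/esym/mlcoefE => N.
by rewrite -gh.
Qed.

Lemma eq_mlcoef_mem L L' g : L =i L' -> mlcoef L g = mlcoef L' g.
Proof.
move=> LL'; rewrite /mlcoef; congr (_@_ _); apply/mnmP => b.
by rewrite !mnmE LL'.
Qed.

Lemma mlcoefB L g h : polyfun g -> polyfun h ->
  mlcoef L (fun N => g N - h N) = mlcoef L g - mlcoef L h.
Proof.
move=> [P Pg] [Q Qh]; rewrite (mlcoefE L Pg) (mlcoefE L Qh) -mcoeffB.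
by apply: mlcoefE => N; rewrite mevalB -Pg -Qh.
Qed.

Lemma mlcoef0 L g : g =1 (fun=> 0) -> mlcoef L g = 0.
Proof.
move=> g0; rewrite -(mcoeff0 _ (multilin L)); apply: mlcoefE => N.
by rewrite meval0 g0.
Qed.

(** Both factors are divisible by N_b, so every monomial of the product has
    exponent at least 2 at b. *)
Lemma mlcoefM_common L (b : nat) g h : (b < p)%N -> polyfun g -> polyfun h ->
  vanishes g b -> vanishes h b -> mlcoef L (fun N => g N * h N) = 0.
Proof.
move=> bp [P Pg] [Q Qh] gb hb.
have PQ : represents (P * Q) (fun N => g N * h N).
  by move=> N; rewrite mevalM -Pg -Qh.
rewrite (mlcoefE L PQ) mcoeffM big1 // => -[k1 k2] /= /eqP e.
have : (k1 (Ordinal bp) + k2 (Ordinal bp) <= 1)%N.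
  by rewrite -mnmDE -e mnmE leq_b1.
have [k0|k0] := posnP (k1 (Ordinal bp)).
  by rewrite (vanishes_coef Pg (b := Ordinal bp)) ?mul0r.
case k2E: (k2 _) => [|n]; first by rewrite (vanishes_coef Qh (b := Ordinal bp)) ?mulr0.
by rewrite -{1}(prednK k0) addnS.
Qed.

(** Only monomials divisible by all N_b with b in L1, respectively L2, occur
    in the two factors, so a single pair of them contributes. *)
Lemma mlcoefM_disjoint L L1 L2 g h :
  (forall b, (b \in L) = (b \in L1) || (b \in L2)) ->
  (forall b, b \in L1 -> b \notin L2) ->
  polyfun g -> polyfun h ->
  (forall b, b \in L1 -> vanishes g b) -> (forall b, b \in L2 -> vanishes h b) ->
  mlcoef L (fun N => g N * h N) = mlcoef L1 g * mlcoef L2 h.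
Proof.
move=> LE L12 [P Pg] [Q Qh] vg vh.
have PQ : represents (P * Q) (fun N => g N * h N).
  by move=> N; rewrite mevalM -Pg -Qh.
rewrite (mlcoefE L PQ) (mlcoefE L1 Pg) (mlcoefE L2 Qh).
have mE : multilin L = (multilin L1 + multilin L2)%MM.
  apply/mnmP => b; rewrite mnmDE !mnmE LE.
  by case: (boolP (_ \in L1)) => [/L12/negPf ->|].
rewrite mcoeffM.
have lt1 : (mdeg (multilin L1) < (mdeg (multilin L)).+1)%N.
  by rewrite mE mdegD ltnS leq_addr.
have lt2 : (mdeg (multilin L2) < (mdeg (multilin L)).+1)%N.
  by rewrite mE mdegD ltnS leq_addl.
rewrite (bigD1 (BMultinom lt1, BMultinom lt2)) /= ?mE //.
rewrite big1 ?addr0 // => -[k1 k2] /= /andP[/eqP/(etrans (esym mE)) e]; apply: contraNeq.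
rewrite mulf_eq0 negb_or => /andP[P1 Q2].
have k1L (b : 'I_p) : (b : nat) \in L1 -> (0 < k1 b)%N.
  by move=> bL; rewrite lt0n; apply: contra P1 => /eqP/(vanishes_coef Pg (vg _ bL)) ->.
have k2L (b : 'I_p) : (b : nat) \in L2 -> (0 < k2 b)%N.
  by move=> bL; rewrite lt0n; apply: contra Q2 => /eqP/(vanishes_coef Qh (vh _ bL)) ->.
have eb b : (k1 b + k2 b = (nat_of_ord b \in L1) + (nat_of_ord b \in L2))%N.
  by rewrite -mnmDE -e mnmDE !mnmE.
have e1 : k1 = multilin L1 :> 'X_{1..p}.
  apply/mnmP => b; rewrite mnmE; move: (eb b) (k1L b) (k2L b) (L12 b).
  case: (_ \in L1); case: (_ \in L2) => //=.
  - by move=> _ _ _ /(_ isT).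
  - by rewrite addn0; case: (k1 b) => [|[|?]] // _ /(_ isT).
  - case: (k2 b) => [|[|n]]; rewrite ?addn1 ?addn0 ?addnS //.
      by move=> _ _ /(_ isT).
    by case.
  - by case: (k1 b).
have e2 : k2 = multilin L2 :> 'X_{1..p}.
  by apply/mnmP => b; move/mnmP: e => /(_ b); rewrite e1 !mnmDE => /addnI.
by apply/eqP; congr (_, _); apply: val_inj.
Qed.

Lemma mlcoef_horner (b : nat) (q : {poly C}) g : (b < p)%N ->
  (forall N, g N = q.[(N b)%:R]) -> mlcoef [:: b] g = q`_1.
Proof.
move=> bp gq; pose bo := Ordinal bp.
rewrite (@mlcoefE _ _ (\sum_(i < size q) q`_i *: 'X_[U_(bo) *+ i])); last first.
  move=> N; rewrite gq horner_coef raddf_sum /=; apply: eq_bigr => i _.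
  rewrite mevalZ mevalX (bigD1 bo) //= big1 ?mulr1 => [|j /negPf jb].
    by rewrite mulmnE mnm1E eqxx mul1n.
  by rewrite mulmnE mnm1E eq_sym jb mul0n expr0.
have -> : multilin [:: b] = (U_(bo) *+ 1)%MM.
  apply/mnmP => j; rewrite mnmE mulmnE mnm1E muln1 inE.
  by rewrite (eq_sym bo).
rewrite raddf_sum /=; have E (i : nat) :
    (q`_i *: 'X_[C, U_(bo) *+ i])@_(U_(bo) *+ 1) = if i == 1%N then q`_1 else 0.
  rewrite mcoeffZ mcoeffX; case: (i =P 1%N) => [->|i1]; first by rewrite eqxx mulr1.
  case: eqP => [/mnmP/(_ bo)|]; rewrite ?mulr0 //.
  by rewrite !mulmnE mnm1E eqxx !mul1n.
rewrite (eq_bigr _ (fun (i : 'I__) _ => E i)).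
have [q1|q1] := leqP (size q) 1.
  rewrite nth_default // big1 // => i _; by case: ifP.
by rewrite -big_mkcond /= (big_pred1 (Ordinal q1)).
Qed.

End PolynomialFunctions.

(** * Separately polynomial functions are polynomial *)

Section SeparatelyPolynomial.
Variable C : numFieldType.

(** Polynomial functions of degree at most n, in the Newton basis of binomial
    coefficients: there, solving a difference equation only shifts the
    coefficients. *)
Definition newton (n : nat) (f : nat -> C) : Prop :=
  exists c : nat -> C, forall t, f t = \sum_(m < n.+1) c m * 'C(t, m)%:R.

Lemma newtonD n f g : newton n f -> newton n g -> newton n (fun t => f t + g t).
Proof.
move=> [c cf] [d dg]; exists (fun k => c k + d k) => t.
by rewrite cf dg -big_split /=; apply: eq_bigr => i _; rewrite mulrDl.
Qed.

Lemma newton_sum n (I : eqType) (r : seq I) (F : I -> nat -> C) :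
  (forall i, i \in r -> newton n (F i)) -> newton n (fun t => \sum_(i <- r) F i t).
Proof.
elim: r => [_|i r IHr Fn].
  by exists (fun=> 0) => t; rewrite big_nil big1 // => k _; rewrite mul0r.
have Fr : newton n (fun t => \sum_(j <- r) F j t).
  by apply: IHr => j jr; apply: Fn; rewrite inE jr orbT.
have [c cE] := newtonD (Fn i (mem_head _ _)) Fr.
by exists c => t; rewrite big_cons cE.
Qed.

Lemma newtonS n f g : (forall t, f t.+1 = f t + g t) -> newton n g -> newton n.+1 f.
Proof.
move=> fS [c cg]; exists (fun k => if k is k'.+1 then c k' else f 0%N).
elim=> [|t IHt]; rewrite big_ord_recl /= bin0 mulr1.
  by rewrite big1 ?addr0 // => i _; rewrite bin0n mulr0.
rewrite fS IHt cg big_ord_recl /= bin0 mulr1 -addrA -big_split /=; congr (_ + _).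
by apply: eq_bigr => i _; rewrite -mulrDr -natrD addnC.
Qed.

Definition binpoly (m : nat) : {poly C} :=
  (m`!%:R)^-1 *: \prod_(i < m) ('X - (i%:R)%:P).

Lemma size_binpoly m : (size (binpoly m) <= m.+1)%N.
Proof.
apply: leq_trans (size_scale_leq _ _) _.
by rewrite size_prod_XsubC /index_enum -enumT size_enum_ord.
Qed.

Lemma horner_binpoly m t : (binpoly m).[t%:R] = 'C(t, m)%:R.
Proof.
have mF : m`!%:R != 0 :> C by rewrite pnatr_eq0 -lt0n fact_gt0.
rewrite hornerZ horner_prod; apply: (mulfI mF); rewrite mulrA divff // mul1r.
rewrite -natrM mulnC bin_ffact; elim: m {mF} => [|m IHm].
  by rewrite big_ord0 ffactn0.
rewrite big_ord_recr /= IHm hornerXsubC ffactnSr natrM.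
have [mt|tm] := leqP m t; first by rewrite natrB.
by rewrite ffact_small // !mul0r.
Qed.

Lemma newton_horner n f : newton n f ->
  exists2 q : {poly C}, (size q <= n.+1)%N & forall t, f t = q.[t%:R].
Proof.
move=> [c cf]; exists (\sum_(m < n.+1) c m *: binpoly m) => [|t].
  apply: leq_trans (size_sum _ _ _) _; apply/bigmax_leqP => i _.
  apply: leq_trans (size_scale_leq _ _) _.
  exact: leq_trans (size_binpoly i) (ltn_ord i).
by rewrite cf horner_sum; apply: eq_bigr => i _; rewrite hornerZ horner_binpoly.
Qed.

(** The values at 0, ..., n determine f through universal polynomials.  This
    expresses f by its own specializations, which is what the induction on the
    number of variables in [polyfun_separately] needs. *)
Lemma newton_interpolation n : exists L : 'I_n.+1 -> {poly C},
  forall f, newton n f -> forall t, f t = \sum_j (L j).[t%:R] * f j.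
Proof.
have inj : injective (fun j : nat => j%:R : C).
  by move=> i j /eqP; rewrite eqr_nat => /eqP.
exists (fun j => tnth (lagrange n.+1 (fun j => j%:R : C)) j).
move=> f /newton_horner[q sq fq] t; rewrite fq {1}(lagrange_gen _ inj sq) //.
by rewrite horner_sum; apply: eq_bigr => j _; rewrite hornerM hornerC mulrC fq.
Qed.

(** Interpolate one variable after the other: the nodal values are functions
    of the same kind in the remaining variables. *)
Lemma polyfun_separately n p (f : (nat -> nat) -> C) :
  (forall N N', (forall b, (b < p)%N -> N b = N' b) -> f N = f N') ->
  (forall b N, (b < p)%N -> newton n (fun t => f (upd N b t))) ->
  polyfun p f.
Proof.
move=> fp fn; have [L LE] := newton_interpolation n.
(* The variables from q on are frozen at N0; Q may ignore them, so v is only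
   prescribed on the first q ones. *)
suff H q : (q <= p)%N -> forall N0, exists Q : {mpoly C[p]},
    forall (N : nat -> nat) (v : 'I_p -> C),
      (forall b, (q <= b)%N -> N b = N0 b) ->
      (forall b : 'I_p, (b < q)%N -> v b = (N b)%:R) -> f N = Q.@[v].
  have [Q QE] := H p (leqnn p) (fun=> 0%N); exists Q => N.
  pose N' b := if (b < p)%N then N b else 0%N.
  have NN' b : (b < p)%N -> N b = N' b by rewrite /N' => ->.
  rewrite (fp _ _ NN'); apply: QE => b; first by rewrite /N' ltnNge => ->.
  by move=> /NN' <-.
elim: q => [_ N0|q IHq qp N0].
  exists (f N0)%:MP => N v NN0 _; rewrite mevalC; apply: fp => b _.
  exact: NN0.
pose qo := Ordinal qp.
have /fin_all_exists[Q QE] (j : 'I_n.+1) := IHq (ltnW qp) (upd N0 q j).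
exists (\sum_j (\sum_(k < size (L j)) (L j)`_k *: 'X_qo ^+ k) * Q j) => N v NN0 vN.
transitivity (f (upd N q (N q))).
  by apply: fp => b _; rewrite /upd; case: eqP => [->|].
rewrite (LE _ (fn _ N qp)) raddf_sum /=; apply: eq_bigr => j _.
rewrite mevalM -(QE j (upd N q j)); first last.
- by move=> b bq; rewrite /upd ltn_eqF // vN // ltnS ltnW.
- move=> b qb; rewrite /upd; case: eqVneq => // bq.
  by apply: NN0; rewrite ltn_neqAle eq_sym bq.
congr (_ * _); rewrite horner_coef raddf_sum /=; apply: eq_bigr => k _.
by rewrite mevalZ rmorphXn /= mevalXU vN /=.
Qed.

End SeparatelyPolynomial.

(** * Expanding the labels of a word into copies *)

Section Choices.
Local Open Scope nat_scope.
Variable A : eqType.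
Implicit Types (w v r : seq (nat * A)) (I J : nat -> seq nat) (N : nat -> nat).

Definition relabel (h : nat -> nat) w : seq (nat * A) :=
  [seq (h a.1, a.2) | a <- w].

Fixpoint choices I w : seq (seq (nat * A)) :=
  if w is (l, x) :: w' then
    [seq (j, x) :: v | j <- I l, v <- choices I w']
  else [:: [::]].

Definition with_label (b : nat) w := [seq a <- w | a.1 == b].

Lemma eq_choices I J w : {in unzip1 w, I =1 J} -> choices I w = choices J w.
Proof.
elim: w => //= -[l x] w IHw IJ /=.
rewrite IJ ?mem_head // IHw // => b bw; by rewrite IJ // in_cons bw orbT.
Qed.

Lemma choices_map h I w :
  choices (fun l => map h (I l)) w = map (relabel h) (choices I w).
Proof.
elim: w => //= -[l x] w ->; rewrite map_allpairs.
by rewrite /allpairs_dep -map_comp; congr flatten; apply: eq_map => j /=; rewrite -map_comp.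
Qed.

Lemma choices_relabel h I w : choices I (relabel h w) = choices (I \o h) w.
Proof. by elim: w => //= -[l x] w ->. Qed.

Lemma choices_all (P Q : pred nat) I w v :
  (forall l j, P l -> j \in I l -> Q j) ->
  all P (unzip1 w) -> v \in choices I w -> all Q (unzip1 v).
Proof.
move=> PQ; elim: w v => [|[l x] w IHw] v /=; first by rewrite inE => _ /eqP->.
move=> /andP[Pl Pw] /allpairsP[[j v'] /= [jI v'I ->]] /=.
by rewrite (PQ l) // IHw.
Qed.

Lemma choices_nil I w b : b \in unzip1 w -> I b = [::] -> choices I w = [::].
Proof.
elim: w => //= -[l x] w IHw; rewrite inE => /orP[/eqP-> /= -> //|bw Ib].
by rewrite IHw //; elim: (I l).
Qed.

End Choices.

Section ChoicesSums.
Variables (A : eqType) (V : nmodType).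
Implicit Types (w v r : seq (nat * A)) (I J : nat -> seq nat) (N : nat -> nat).

Lemma sum_choices_cons I l x w (F : seq (nat * A) -> V) :
  \sum_(v <- choices I ((l, x) :: w)) F v =
  \sum_(j <- I l) \sum_(v <- choices I w) F ((j, x) :: v).
Proof. by rewrite /= big_allpairs_dep. Qed.

Lemma sum_choices_cat I w1 w2 (F : seq (nat * A) -> V) :
  \sum_(v <- choices I (w1 ++ w2)) F v =
  \sum_(v1 <- choices I w1) \sum_(v2 <- choices I w2) F (v1 ++ v2).
Proof.
elim: w1 F => [|[l x] w1 IHw] F; first by rewrite /= big_seq1.
rewrite cat_cons !sum_choices_cons; apply: eq_bigr => j _.
by rewrite (IHw (fun v => F ((j, x) :: v))).
Qed.

(** This allows to single out one copy of a label: first decide which letters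
    use it, then choose the other indices. *)
Lemma sum_choices_comp (T : nat -> seq nat) I J w (F : seq (nat * A) -> V) :
  (forall l, I l = flatten [seq J k | k <- T l]) ->
  \sum_(v <- choices I w) F v =
  \sum_(u <- choices T w) \sum_(v <- choices J u) F v.
Proof.
move=> IJ; elim: w F => [|[l x] w IHw] F; first by rewrite /= !big_seq1.
rewrite !sum_choices_cons IJ big_flatten big_map; apply: eq_bigr => k _ /=.
under [RHS]eq_bigr => u _ do rewrite sum_choices_cons.
by rewrite [RHS]exchange_big /=; apply: eq_bigr => j _; rewrite IHw.
Qed.

End ChoicesSums.

(** Choices for the letters with labels in P and for the other letters are
    independent; Q recognizes the former by the chosen index. *)
Lemma sum_choices_filter (A : eqType) (R : pzSemiRingType) (I : nat -> seq nat)
    (P Q : pred nat) (w : seq (nat * A)) (F G : seq (nat * A) -> R) :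
  (forall l j, l \in unzip1 w -> j \in I l -> Q j = P l) ->
  \sum_(v <- choices I w)
     F [seq a <- v | Q a.1] * G [seq a <- v | ~~ Q a.1] =
  (\sum_(v <- choices I [seq a <- w | P a.1]) F v) *
  (\sum_(v <- choices I [seq a <- w | ~~ P a.1]) G v).
Proof.
elim: w F G => [|[l x] w IHw] F G PQ; first by rewrite /= !big_seq1.
have {}IHw F' G' := IHw F' G'
  (fun k j (kw : k \in unzip1 w) => PQ k j (@mem_behead _ (l :: unzip1 w) k kw)).
rewrite sum_choices_cons /=; case: ifP => Pl /=.
  rewrite sum_choices_cons big_distrl /=; apply: eq_big_seq => j jI.
  rewrite -(IHw (fun v => F ((j, x) :: v))); apply: eq_bigr => v _.
  by rewrite (PQ l) ?mem_head // Pl.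
rewrite sum_choices_cons big_distrr /=; apply: eq_big_seq => j jI.
rewrite -(IHw _ (fun v => G ((j, x) :: v))); apply: eq_bigr => v _.
by rewrite (PQ l) ?mem_head // Pl.
Qed.

(** * Stacking the copies of the labels *)

Section Stacking.
Local Open Scope nat_scope.
Implicit Types (N : nat -> nat).

Definition offset N (l : nat) : nat := \sum_(k < l) N k.

(** The N l indices of the label l; the intervals follow each other without
    gaps, in the order of the labels. *)
Definition stack N (l : nat) : seq nat := iota (offset N l) (N l).

Lemma offsetS N l : offset N l.+1 = offset N l + N l.
Proof. by rewrite /offset big_ord_recr. Qed.

Lemma offset_le N l l' : l <= l' -> offset N l <= offset N l'.
Proof.
move=> /subnK <-; elim: (l' - l) => //= n IH.
by rewrite offsetS (leq_trans IH) ?leq_addr.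
Qed.

Lemma eq_offset N N' l : (forall k, k < l -> N k = N' k) -> offset N l = offset N' l.
Proof. by move=> NN'; apply: eq_bigr => k _; exact: NN'. Qed.

Lemma mem_stack N l j : (j \in stack N l) = (offset N l <= j < offset N l.+1).
Proof. by rewrite mem_iota offsetS. Qed.

Lemma stack_lt N l l' j j' :
  l < l' -> j \in stack N l -> j' \in stack N l' -> j < j'.
Proof.
rewrite !mem_stack => ll' /andP[_ j1] /andP[j2 _].
by apply: leq_trans j1 (leq_trans (offset_le N ll') j2).
Qed.

Lemma stack_inj N l l' j : j \in stack N l -> j \in stack N l' -> l = l'.
Proof.
by case: (ltngtP l l') => // ll' jl jl';
  [have := stack_lt ll' jl jl' | have := stack_lt ll' jl' jl]; rewrite ltnn.
Qed.

(** N with a new label b+1 of multiplicity 1, the labels above b being shifted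
    by one. *)
Definition insert_one (b : nat) N (l : nat) : nat :=
  if l <= b then N l else if l == b.+1 then 1 else N l.-1.

(** The new names of the label l when the last copy of b becomes a label of its
    own, called b+1. *)
Definition split_label (b l : nat) : seq nat :=
  if l < b then [:: l] else if l == b then [:: b; b.+1] else [:: l.+1].

Lemma offset_insert_low b N l : l <= b.+1 -> offset (insert_one b N) l = offset N l.
Proof.
move=> lb; apply: eq_offset => k kl; rewrite /insert_one -ltnS.
by rewrite (leq_trans kl lb).
Qed.

Lemma offset_insert_high b N l : b < l ->
  offset (insert_one b N) l.+1 = (offset N l).+1.
Proof.
elim: l => // l IHl; rewrite ltnS leq_eqVlt => /predU1P[->|bl].
  by rewrite offsetS offset_insert_low // /insert_one ltnn eqxx addn1.
rewrite offsetS IHl // [in RHS]offsetS /insert_one /= ltnNge (ltnW bl) /=.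
by rewrite eqSS gtn_eqF.
Qed.

End Stacking.

Definition shift_above (b l : nat) : nat := if (l <= b)%N then l else l.+1.

(** Exactly one of the splittings of w uses only the old copies of b; all
    others move at least one letter away from the label b. *)
Lemma choices_split_label (A : eqType) b (w : seq (nat * A)) : exists2 rest,
  choices (split_label b) w = relabel (shift_above b) w :: rest &
  forall u, u \in rest ->
    (count (fun a => a.1 == b) u < count (fun a => a.1 == b) w)%N.
Proof.
have cnt0 (w' : seq (nat * A)) : count (fun a => a.1 == b) (relabel (shift_above b) w') =
    count (fun a => a.1 == b) w'.
  rewrite /relabel count_map; apply: eq_count => -[l x] /=; rewrite /shift_above.
  case: (ltngtP l b) => bl; [exact: ltn_eqF | by rewrite gtn_eqF // ltnW | by rewrite bl eqxx].
elim: w => [|[l x] w [rest cE IH]]; first by exists [::].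
rewrite /= cE -/(relabel _ w) /split_label [shift_above b l]/shift_above.
case: (ltngtP l b) => lb /=.
- exists [seq (l, x) :: v | v <- rest] => [|_ /mapP[u /IH ur ->] /=].
    by rewrite cats0.
  by rewrite ltn_eqF.
- exists [seq (l.+1, x) :: v | v <- rest] => [|_ /mapP[u /IH ur ->] /=].
    by rewrite cats0.
  by rewrite gtn_eqF // ltnW.
subst l; exists ([seq (b, x) :: v | v <- rest] ++
    [seq (b.+1, x) :: v | v <- relabel (shift_above b) w :: rest]).
  by rewrite cats0.
move=> u; rewrite mem_cat => /orP[/mapP[v /IH vr ->]|/mapP[v vr ->]] /=.
  by rewrite eqxx ltn_add2l.
rewrite gtn_eqF //= add0n add1n ltnS; move: vr.
by rewrite inE => /predU1P[->|/IH/ltnW //]; rewrite cnt0.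
Qed.

(** * Sums of expectations over all expansions *)

Section Dot.
Variables (C : numFieldType) (A : eqType) (E : seq (nat * A) -> C).
Implicit Types (w v r : seq (nat * A)) (N : nat -> nat).

Definition dot N w : C := \sum_(v <- choices (stack N) w) E v.

Lemma eq_dot_lt p N N' w : all (gtn p) (unzip1 w) ->
  (forall b, (b < p)%N -> N b = N' b) -> dot N w = dot N' w.
Proof.
move=> /allP wp NN'; rewrite /dot (@eq_choices _ _ (stack N')) // => b /wp /= bp.
rewrite /stack NN' //; congr iota; apply: eq_offset => k kb.
by apply: NN'; apply: ltn_trans bp.
Qed.

Lemma eq_dot N N' w : N =1 N' -> dot N w = dot N' w.
Proof.
move=> NN'; rewrite /dot (@eq_choices _ _ (stack N')) // => b _.
by rewrite /stack NN' (eq_offset (N' := N')).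
Qed.

Lemma dot_vanishes b w : b \in unzip1 w -> vanishes (dot^~ w) b.
Proof.
by move=> bw N Nb; rewrite /dot (choices_nil bw) ?big_nil // /stack Nb.
Qed.

Hypothesis E_relabel : forall h v, {homo h : i j / (i < j)%N} ->
  E (relabel h v) = E v.

Lemma sum_choices_relabel h (I : nat -> seq nat) w : {homo h : i j / (i < j)%N} ->
  \sum_(v <- choices (fun l => map h (I l)) w) E v = \sum_(v <- choices I w) E v.
Proof.
by move=> hh; rewrite choices_map big_map; apply: eq_bigr => v _; rewrite E_relabel.
Qed.

Lemma dot_split b N w :
  dot (upd N b (N b).+1) w = \sum_(u <- choices (split_label b) w) dot (insert_one b N) u.
Proof.
apply: sum_choices_comp => l; rewrite /split_label.
have offU k : (k <= b)%N -> offset (upd N b (N b).+1) k = offset N k.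
  by move=> kb; apply: eq_offset => i ik; rewrite /upd ltn_eqF // (leq_trans ik).
have offU' k : (b < k)%N -> offset (upd N b (N b).+1) k = (offset N k).+1.
  elim: k => // k IHk; rewrite ltnS leq_eqVlt => /predU1P[<-|bk].
    by rewrite !offsetS offU // /upd eqxx addnS.
  by rewrite offsetS IHk // /upd gtn_eqF // [in RHS]offsetS.
rewrite /stack; case: (ltngtP l b) => [lb|bl|->] /=; rewrite ?cats0.
- rewrite offU 1?ltnW // offset_insert_low 1?ltnW // 1?ltnW //.
  by rewrite /upd ltn_eqF // /insert_one ltnW.
- rewrite offU' // offset_insert_high // /upd gtn_eqF // /insert_one ltnNge.
  by rewrite (ltnW bl) /= eqSS gtn_eqF.
rewrite offU // !offset_insert_low // /upd eqxx /insert_one leqnn ltnn eqxx.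
by rewrite offsetS -addn1 iotaD.
Qed.

(** A copy that no letter uses can be removed: this is where the invariance of
    E under order-preserving changes of indices enters. *)
Lemma dot_unsplit b N w :
  dot (insert_one b N) (relabel (shift_above b) w) = dot N w.
Proof.
rewrite /dot choices_relabel.
(* h skips the inserted copy, which lies just above the copies of b. *)
pose h x := if (x < offset N b.+1)%N then x else x.+1.
have hh : {homo h : i j / (i < j)%N}.
  move=> i j ij; rewrite /h.
  case: (ltnP i) => ib; case: (ltnP j) => jb //; first exact: ltnW.
  by move: (leq_trans ib (ltnW ij)); rewrite leqNgt jb.
rewrite -(sum_choices_relabel (stack N) w hh); congr (\sum_(v <- _) _).
apply: eq_choices => l _ /=; rewrite /stack /shift_above.
have [lb|bl] := leqP l b.
  rewrite offset_insert_low 1?leqW // /insert_one lb.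
  rewrite -[LHS]map_id; apply/eq_in_map => x; rewrite mem_iota -offsetS /h => /andP[_ xl].
  by rewrite (leq_trans xl) // offset_le.
rewrite offset_insert_high // /insert_one ltnNge (ltnW bl) /= eqSS gtn_eqF //.
rewrite -[(offset N l).+1]add1n iotaDl; apply/eq_in_map => x.
rewrite mem_iota /h => /andP[xl _].
by rewrite ltnNge (leq_trans _ xl) // offset_le.
Qed.

(** The letters that choose the last of t+1 copies of b are relabelled; if
    there are none, what remains is the sum for t copies. *)
Lemma dot_succ b N w : exists2 rest,
  forall t, dot (upd N b t.+1) w = dot (upd N b t) w +
    \sum_(u <- rest) dot (upd (insert_one b N) b t) u &
  forall u, u \in rest ->
    (count (fun a => a.1 == b) u < count (fun a => a.1 == b) w)%N.
Proof.
have [rest cE IH] := choices_split_label b w; exists rest => // t.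
transitivity (dot (upd (upd N b t) b (upd N b t b).+1) w).
  by apply: eq_dot => l; rewrite /upd eqxx; case: eqP.
rewrite dot_split cE big_cons dot_unsplit; congr (_ + _).
apply: eq_bigr => u _; apply: eq_dot => l; rewrite /insert_one /upd.
case: (ltngtP l b) => //= bl; case: (eqVneq l b.+1) => // lb.
by case: l bl lb => // l; rewrite ltnS eqSS /= => _ /negPf->.
Qed.

(** Induction on the number of letters labelled b, which drops in the
    difference with respect to N b. *)
Lemma newton_dot n b N w : (count (fun a => a.1 == b) w <= n)%N ->
  newton n (fun t => dot (upd N b t) w).
Proof.
elim: n w N => [|n IHn] w N cw; have [rest dotS IH] := dot_succ b N w.
  exists (fun=> dot (upd N b 0) w) => t.
  rewrite big_ord1 bin0 mulr1; elim: t => // t <-.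
  rewrite dotS big1_seq ?addr0 // => u /andP[_ /IH].
  by move: cw; rewrite leqn0 => /eqP->.
apply: newtonS dotS _; apply: newton_sum => u /IH uw; apply: IHn.
by rewrite -ltnS (leq_trans uw).
Qed.

Lemma polyfun_dot p w : all (gtn p) (unzip1 w) -> polyfun p (dot^~ w).
Proof.
move=> wp; apply: (@polyfun_separately _ (size w)).
  by move=> N N'; apply: eq_dot_lt wp.
by move=> b N _; apply: newton_dot; exact: count_size.
Qed.

(** By invariance the position of the stack of b is irrelevant, so that the
    polynomial depends on the letters only. *)
Lemma dot_one_label xs : exists q : {poly C},
  forall b N, dot N [seq (b, x) | x <- xs] = q.[(N b)%:R].
Proof.
have [q _ qE] := newton_horner (newton_dot (fun=> 0%N)
  (leqnn (count (fun a => a.1 == 0%N) [seq (0%N, x) | x <- xs]))).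
exists q => b N; rewrite -qE /dot.
have -> : [seq (b, x) | x <- xs] = relabel (fun=> b) [seq (0%N, x) | x <- xs].
  by rewrite /relabel -map_comp.
have hh : {homo addn (offset N b) : i j / (i < j)%N} by move=> i j; rewrite ltn_add2l.
rewrite choices_relabel -[RHS](sum_choices_relabel _ _ hh); congr (\sum_(v <- _) _).
apply: eq_choices => l /=; rewrite /unzip1 -map_comp => /mapP[x _ /= ->].
rewrite /stack -iotaDl (_ : offset (upd _ _ _) 0 = 0%N) ?addn0 //.
by rewrite /offset big_ord0.
Qed.

Hypothesis E_nil : E [::] = 1.

(** For the word of an ordered set partition this is its cumulant, see
    [cumulant_wcum]. *)
Definition wcum p w : C := mlcoef p (unzip1 w) (dot^~ w).

Lemma wcum_nil p : wcum p [::] = 1.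
Proof.
have r1 : represents (1 : {mpoly C[p]}) (dot^~ [::]).
  by move=> N; rewrite meval1 /dot big_seq1.
by rewrite /wcum (mlcoefE _ r1) mcoeff1 (_ : multilin _ _ = 0%MM) ?eqxx.
Qed.

Lemma wcum_one_label p b p' b' xs : (b < p)%N -> (b' < p')%N ->
  wcum p [seq (b, x) | x <- xs] = wcum p' [seq (b', x) | x <- xs].
Proof.
move=> bp bp'; case: xs => [|x xs]; first by rewrite !wcum_nil.
have [q qE] := dot_one_label (x :: xs).
have mE (c : nat) : unzip1 [seq (c, x) | x <- x :: xs] =i [:: c].
  move=> l; rewrite /unzip1 -map_comp; apply/mapP/idP => [[y _ ->]|].
    exact: mem_head.
  by rewrite inE => /eqP->; exists x; rewrite ?mem_head.
rewrite /wcum !(eq_mlcoef_mem _ _ (mE _)).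
by rewrite (mlcoef_horner bp (qE b)) (mlcoef_horner bp' (qE b')).
Qed.

Lemma wcum_peel p w r w' :
  all (gtn p) (unzip1 w) ->
  (forall b, (b \in unzip1 w) = (b \in unzip1 r) || (b \in unzip1 w')) ->
  (forall b, b \in unzip1 r -> b \notin unzip1 w') ->
  (forall N, dot N w = dot N r * dot N w') ->
  wcum p w = wcum p r * wcum p w'.
Proof.
move=> /allP wp ww dis dw.
have rp : all (gtn p) (unzip1 r) by apply/allP => b br; apply: wp; rewrite ww br.
have w'p : all (gtn p) (unzip1 w').
  by apply/allP => b bw; apply: wp; rewrite ww bw orbT.
rewrite /wcum (@eq_mlcoef _ _ _ _ (fun N => dot N r * dot N w')) //; last first.
  by apply: polyfun_dot; exact/allP.
apply: mlcoefM_disjoint => //; try exact: polyfun_dot.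
all: by move=> b; exact: dot_vanishes.
Qed.

Lemma wcum_eq0 p w r w' b :
  all (gtn p) (unzip1 w) -> all (gtn p) (unzip1 r) -> all (gtn p) (unzip1 w') ->
  b \in unzip1 r -> b \in unzip1 w' ->
  (forall N, dot N w = dot N r * dot N w') -> wcum p w = 0.
Proof.
move=> wp rp w'p br bw' dw.
rewrite /wcum (@eq_mlcoef _ _ _ _ (fun N => dot N r * dot N w')) //; last first.
  exact: polyfun_dot.
apply: (@mlcoefM_common _ _ _ b); try exact: polyfun_dot; try exact: dot_vanishes.
by move/allP: rp; apply.
Qed.

(** Labels that do not occur in w contribute the factor 1.  For the word of an
    ordered set partition this is the product of the cumulants of its blocks,
    see [block_cumulant_wcum]. *)
Definition block_wcum p w : C := \prod_(b < p) wcum p (with_label b w).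

Lemma block_wcum_peel p w r w' l : (l < p)%N ->
  (forall b, with_label b w = if b == l then r else with_label b w') ->
  l \notin unzip1 w' -> block_wcum p w = wcum p r * block_wcum p w'.
Proof.
move=> lp wE lw'; rewrite /block_wcum (bigD1 (Ordinal lp)) //= wE eqxx; congr (_ * _).
rewrite [RHS](bigD1 (Ordinal lp)) //= (_ : with_label l w' = [::]); last first.
  apply/eqP; rewrite -size_eq0 size_filter -leqn0 leqNgt -has_count.
  by apply: contra lw' => /hasP[a aw /eqP <-]; rewrite map_f.
rewrite wcum_nil mul1r; apply: eq_bigr => b bl.
by rewrite wE; case: eqP => // bl'; case/eqP: bl; apply: val_inj.
Qed.

(** What an independence has to provide for one step of the factorization: a
    single label l is split off, in a way that respects both [dot] and the class
    of label sequences with nonzero cumulants. *)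
Definition peelable (nice : seq nat -> Prop) w : Prop :=
  exists r w' l,
    [/\ (0 < size r)%N, unzip1 r = nseq (size r) l, size w = (size r + size w')%N &
        forall b, with_label b w = if b == l then r else with_label b w'] /\
    [/\ l \notin unzip1 w', forall N, dot N w = dot N r * dot N w' &
        nice (unzip1 w) <-> nice (unzip1 w')].

Lemma mem_labels b w : (b \in unzip1 w) = (with_label b w != [::]).
Proof.
rewrite -size_eq0 size_filter -lt0n -has_count; apply/mapP/hasP => -[a aw].
  by move=> ->; exists a.
by move=> /eqP <-; exists a.
Qed.

(** Peeling off one label at a time, by induction on the length of w. *)
Theorem wcum_factorization p (nice : seq nat -> Prop) : nice [::] ->
  (forall w, w != [::] -> all (gtn p) (unzip1 w) ->
     peelable nice w \/ (wcum p w = 0 /\ ~ nice (unzip1 w))) ->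
  forall w, all (gtn p) (unzip1 w) ->
    (nice (unzip1 w) -> wcum p w = block_wcum p w) /\
    (~ nice (unzip1 w) -> wcum p w = 0).
Proof.
move=> nice0 step w; have [n] := ubnP (size w); elim: n w => // n IHn w.
rewrite ltnS => wn wp; have [->|w0] := eqVneq w [::].
  split=> // _; rewrite wcum_nil /block_wcum big1 // => b _; exact: wcum_nil.
have [|[-> nw]] := step w w0 wp; last by split.
move=> [r [w' [l [[r0 rl sw wE] [lw' dw nE]]]]].
have lr : l \in unzip1 r by rewrite rl mem_nseq r0 eqxx.
have rE b : (b \in unzip1 r) = (b == l) by rewrite rl mem_nseq r0.
have ww b : (b \in unzip1 w) = (b \in unzip1 r) || (b \in unzip1 w').
  rewrite rE [in LHS]mem_labels wE; case: (eqVneq b l) => _; last by rewrite mem_labels.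
  by rewrite -size_eq0 -lt0n.
have lp : (l < p)%N by move/allP: wp; apply; rewrite ww lr.
have [] := IHn w'.
- by apply: leq_trans wn; rewrite sw -[X in (X < _)%N]add0n ltn_add2r.
- by apply/allP => b bw; move/allP: wp; apply; rewrite ww bw orbT.
move=> IH1 IH0; rewrite (wcum_peel (r := r) (w' := w')) //; last first.
  by move=> b; rewrite rE => /eqP->.
rewrite (block_wcum_peel lp wE lw').
by split=> nw; [rewrite IH1 //; apply/nE | rewrite IH0 ?mulr0 // => /nE].
Qed.

End Dot.

(** * Ordered kernels and quasi-meets *)

Section OrderedKernels.
Local Open Scope nat_scope.
Variable n : nat.
Implicit Types (f : 'I_n -> nat) (B : {set 'I_n}) (rho : osp n).

Definition below f B B' : bool := [forall k in B, forall l in B', f k < f l].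

Lemma belowP f B B' :
  reflect (forall k l, k \in B -> l \in B' -> f k < f l) (below f B B').
Proof.
apply: (iffP forall_inP) => [H k l kB lB'|H k kB].
  by have /forall_inP := H k kB; apply.
by apply/forall_inP => l lB'; apply: H.
Qed.

Lemma okernel_below f : pairwise (below f) (blocks (okernel f)).
Proof.
apply: subseq_pairwise (filter_subseq _ _) _; rewrite pairwise_map.
have : pairwise ltn (sort leq (undup (codom f))).
  rewrite -(sorted_pairwise ltn_trans) ltn_sorted_uniq_leq sort_uniq undup_uniq.
  exact: sort_sorted leq_total _.
apply: sub_pairwise => v w /= vw; apply/belowP => k l.
by rewrite !inE => /eqP-> /eqP->.
Qed.

Lemma okernel_const f B k l :
  B \in blocks (okernel f) -> k \in B -> l \in B -> f k = f l.
Proof. by rewrite mem_filter => /andP[_ /mapP[v _ ->]]; rewrite !inE => /eqP-> /eqP->. Qed.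

Lemma block_of_const f rho B k : pairwise (below f) (blocks rho) ->
  (forall B k l, B \in blocks rho -> k \in B -> l \in B -> f k = f l) ->
  B \in blocks rho -> k \in B -> B = [set l | f l == f k].
Proof.
move=> bel const Bs kB; apply/setP => l; rewrite inE; apply/idP/eqP => [lB|flk].
  exact: const Bs lB kB.
have [B' B's lB'] := osp_cover rho l.
have bi : index B (blocks rho) < size (blocks rho) by rewrite index_mem.
have bi' : index B' (blocks rho) < size (blocks rho) by rewrite index_mem.
have /(pairwiseP set0) pw := bel.
case: (ltngtP (index B (blocks rho)) (index B' (blocks rho))) => [lt|gt|eq].
- have := pw _ _ bi bi' lt; rewrite !nth_index // => /belowP/(_ k l kB lB').
  by rewrite flk ltnn.
- have := pw _ _ bi' bi gt; rewrite !nth_index // => /belowP/(_ l k lB' kB).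
  by rewrite flk ltnn.
- by rewrite -(nth_index set0 Bs) eq nth_index.
Qed.

(** Both sides list the level sets of f in the strict order [below f], and a
    list without repetitions sorted by a strict order is determined by its
    elements. *)
Lemma okernel_unique f rho : pairwise (below f) (blocks rho) ->
  (forall B k l, B \in blocks rho -> k \in B -> l \in B -> f k = f l) ->
  okernel f = rho.
Proof.
move=> bel const; apply: val_inj => /=.
pose R B B' := [&& B != set0, B' != set0 & below f B B'].
have Rtr : transitive R.
  move=> B2 B1 B3 /and3P[b1 /set0Pn[m m2] /belowP b12] /and3P[_ b3 /belowP b23].
  apply/and3P; split=> //; apply/belowP => k l k1 l3.
  exact: ltn_trans (b12 _ _ k1 m2) (b23 _ _ m2 l3).
have Rirr : irreflexive R.
  move=> B; apply/negP => /and3P[/set0Pn[m mB] _ /belowP/(_ m m mB mB)].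
  by rewrite ltnn.
have Rsort (tau : osp n) : pairwise (below f) (blocks tau) -> sorted R (blocks tau).
  rewrite (sorted_pairwise Rtr) => taub.
  apply: (@sub_in_pairwise _ (mem (blocks tau)) (below f)) => //.
    by move=> B B' Bt B't bb; rewrite /R bb !(osp_neq0 (pi := tau)).
have mem_tau (tau : osp n) : pairwise (below f) (blocks tau) ->
    (forall B k l, B \in blocks tau -> k \in B -> l \in B -> f k = f l) ->
    forall B, reflect (exists k, B = [set l | f l == f k]) (B \in blocks tau).
  move=> taub tauc B; apply: (iffP idP) => [Bt|[k ->]].
    have /set0Pn[k kB] := osp_neq0 Bt; exists k; exact: block_of_const Bt kB.
  have [B' B't kB'] := osp_cover tau k.
  by rewrite -(block_of_const taub tauc B't kB').
apply: (irr_sorted_eq Rtr Rirr) => [||B].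
- exact: (Rsort (okernel f) (okernel_below f)).
- exact: Rsort.
apply/(mem_tau (okernel f) (okernel_below f) (@okernel_const f))/(mem_tau rho) => //.
Qed.

Lemma okernel_comp (h : nat -> nat) f : {homo h : i j / i < j} ->
  okernel (h \o f) = okernel f.
Proof.
move=> hh; apply: okernel_unique => [|B k l Bs kB lB /=].
  apply: sub_pairwise (okernel_below f) => B B' /belowP b; apply/belowP => k l kB lB'.
  exact/hh/b.
by rewrite (okernel_const Bs kB lB).
Qed.

Lemma block_index_const rho B k l :
  B \in blocks rho -> k \in B -> l \in B -> block_index rho k = block_index rho l.
Proof.
move=> Bs kB lB; have Bi : index B (blocks rho) < size (blocks rho) by rewrite index_mem.
transitivity (index B (blocks rho)); last apply/esym; apply/eqP.
  by rewrite block_index_nth // nth_index.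
by rewrite block_index_nth // nth_index.
Qed.

Lemma block_index_lt rho k : block_index rho k < size (blocks rho).
Proof.
by rewrite -has_find; apply/hasP; have [B Bs kB] := osp_cover rho k; exists B.
Qed.

Lemma block_index_below rho : pairwise (below (block_index rho)) (blocks rho).
Proof.
apply/(pairwiseP set0) => a b ra rb ab; apply/belowP => k l.
by rewrite -!block_index_nth // => /eqP-> /eqP->.
Qed.

(** The stacked indices are ordered lexicographically, first by the block of
    rho and then by f, as are the blocks of the quasi-meet. *)
Lemma okernel_stack N rho (f : 'I_n -> nat) : (forall k, f k < N (block_index rho k)) ->
  okernel (fun k => offset N (block_index rho k) + f k) = qmeet rho (okernel f).
Proof.
move=> fN; apply: okernel_unique => [|B k l]; last first.
  rewrite mem_filter => /andP[_ /allpairsP[[P Q] /= [Pr Qf ->]]].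
  rewrite !inE => /andP[kP kQ] /andP[lP lQ].
  by rewrite (block_index_const Pr kP lP) (okernel_const Qf kQ lQ).
apply: subseq_pairwise (filter_subseq _ _) _.
have := okernel_below f; have := block_index_below rho.
have : {subset blocks rho <= blocks rho} by [].
elim: {1 3 4}(blocks rho) => //= P s IHs sub /andP[/allP dP ds] df.
have Pr := sub _ (mem_head _ _).
rewrite pairwise_cat IHs //; last first.
  by move=> Q Qs; apply: sub; rewrite inE Qs orbT.
rewrite andbT pairwise_map; apply/andP; split.
  apply/allrelP => _ _ /mapP[Q _ ->] /allpairsP[[P' Q'] /= [P's _ ->]].
  have /belowP PP' := dP _ P's; apply/belowP => k l; rewrite !inE.
  move=> /andP[/PP' kP _] /andP[/kP kl _].
  apply: leq_trans (leq_trans (offset_le N kl) (leq_addr _ _)).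
  by rewrite offsetS ltn_add2l.
apply: sub_pairwise df => Q Q' /belowP QQ'; apply/belowP => k l; rewrite !inE.
move=> /andP[kP kQ] /andP[lP lQ'].
by rewrite (block_index_const Pr kP lP) ltn_add2l QQ'.
Qed.

End OrderedKernels.

(** * Cumulants as multilinear coefficients of words *)

Section WordExpectation.
Variables (C : numFieldType) (A U : nuAlgType C) (phi : {scalar A}).
Variable S : spreadability_system U phi.
Implicit Types (w v : seq (nat * A)).

(** The empty word need not have a product in U; its value 1 is neutral for the
    factorizations below. *)
Definition expect v : C :=
  if v is [::] then 1 else ss_phi S (word (ss_iota S) v).

Lemma expect_nil : expect [::] = 1.
Proof. by []. Qed.

Lemma expect_cons a v : expect (a :: v) = ss_phi S (word (ss_iota S) (a :: v)).
Proof. by []. Qed.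

Lemma expectE v : v != [::] -> expect v = ss_phi S (word (ss_iota S) v).
Proof. by case: v. Qed.

Lemma size_labelled n (i : 'I_n -> nat) (X : 'I_n -> A) : size (labelled i X) = n.
Proof. by rewrite size_map size_enum_ord. Qed.

Lemma word_labelled v : exists X, labelled (fun k : 'I_(size v) => (nth (0%N, 0) v k).1) X = v.
Proof.
exists (fun k => (nth (0%N, 0) v k).2); apply: (@eq_from_nth _ (0%N, 0)) => [|k].
  exact: size_labelled.
rewrite size_labelled => kv; rewrite (nth_map (Ordinal kv)) ?size_enum_ord //.
by rewrite nth_enum_ord //; case: nth.
Qed.

(** Spreadability, in the form used below. *)
Lemma expect_relabel h v : {homo h : i j / (i < j)%N} -> expect (relabel h v) = expect v.
Proof.
case: v => // a v hh; have [X] := word_labelled (a :: v).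
set f := (fun k : 'I_(size (a :: v)) => _) => vE.
rewrite expect_cons expectE // -{}vE.
rewrite (_ : relabel h _ = labelled (h \o f) X).
  by apply: ss_spreadable; exact: okernel_comp.
by rewrite /relabel /labelled -map_comp.
Qed.

Lemma mem_choices_map (T : Type) (I : nat -> seq nat) (f b : T -> nat) (X : T -> A) s :
  (forall k, f k \in I (b k)) ->
  [seq (f k, X k) | k <- s] \in choices I [seq (b k, X k) | k <- s].
Proof.
move=> fI; elim: s => [|k s IHs] /=; first by rewrite inE.
by apply/allpairsP; exists (f k, [seq (f k, X k) | k <- s]); split; [exact: fI|exact: IHs|].
Qed.

Lemma size_choices_prod (I : nat -> seq nat) w :
  size (choices I w) = foldr muln 1%N [seq size (I a.1) | a <- w].
Proof. by elim: w => //= -[l x] w <-; rewrite size_allpairs. Qed.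

(** The assignments of copies to positions give pairwise distinct choices, and
    there are as many of them as choices. *)
Lemma sum_choices_dffun (n : nat) (b : 'I_n -> nat) (N : nat -> nat) (X : 'I_n -> A)
    (F : seq (nat * A) -> C) :
  \sum_(v <- choices (stack N) (labelled b X)) F v =
  \sum_(i : {dffun forall k : 'I_n, 'I_(N (b k))})
     F (labelled (fun k => offset N (b k) + i k)%N X).
Proof.
pose T := {dffun forall k : 'I_n, 'I_(N (b k))}.
pose G (i : T) := labelled (fun k => offset N (b k) + i k)%N X.
have Ginj : injective G.
  move=> i j /eq_in_map ij; apply/ffunP => k.
  by have := ij k (mem_enum _ _) => -[/addnI/val_inj].
have Guniq : uniq [seq G i | i : T] by rewrite map_inj_uniq // enum_uniq.
have Gsub : {subset [seq G i | i : T] <= choices (stack N) (labelled b X)}.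
  move=> _ /mapP[i _ ->]; apply: mem_choices_map => k.
  by rewrite mem_stack leq_addr offsetS ltn_add2l ltn_ord.
have Gsize : (size (choices (stack N) (labelled b X)) <= size [seq G i | i : T])%N.
  rewrite size_map -cardE card_dep_ffun size_choices_prod -map_comp.
  apply: eq_leq; congr (foldr muln 1%N _); apply: eq_map => k /=.
  by rewrite card_ord /stack size_iota.
have perm : perm_eq (choices (stack N) (labelled b X)) [seq G i | i : T].
  rewrite uniq_perm ?(leq_size_uniq Guniq) //.
  by move=> v; have [_ ->] := uniq_min_size Guniq Gsub Gsize.
by rewrite (perm_big _ perm) big_map big_enum.
Qed.

Lemma phi_dot_expect n (pi : osp n) (N : nat -> nat) (X : 'I_n -> A) : (0 < n)%N ->
  phi_dot S pi (fun k => N (block_index pi k)) X =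
  dot expect N (labelled (block_index pi) X).
Proof.
move=> n0; rewrite /dot sum_choices_dffun; apply: eq_bigr => i _.
rewrite expectE -?size_eq0 ?size_labelled -?lt0n //; apply: ss_spreadable.
by rewrite okernel_block_index okernel_stack.
Qed.

Lemma labelled_lt n (pi : osp n) (X : 'I_n -> A) :
  all (gtn (size (blocks pi))) (unzip1 (labelled (block_index pi) X)).
Proof.
apply/allP => _ /mapP[_ /mapP[k _ ->] ->] /=; exact: block_index_lt.
Qed.

Lemma cumulant_wcum n (pi : osp n) (X : 'I_n -> A) : (0 < n)%N ->
  cumulant S pi X = wcum expect (size (blocks pi)) (labelled (block_index pi) X).
Proof.
move=> n0; have [Q QE] := polyfun_dot expect_relabel (labelled_lt pi X).
rewrite /wcum (mlcoefE _ QE) /cumulant.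
have Qdot : is_dot_poly S X Q by move=> N _; rewrite phi_dot_expect // QE.
have -> : dot_poly S pi X = Q.
  have xdot : is_dot_poly S X (dot_poly S pi X) := classical_sets.xgetI 0 Qdot.
  apply/eqP; rewrite -subr_eq0; apply/eqP/mpoly_nat_eq0 => N N0.
  by rewrite mevalB -(xdot N N0) -(Qdot N N0) subrr.
congr (_@_ _); apply/mnmP => b; rewrite !mnmE.
have /set0Pn[k kb] : nth set0 (blocks pi) b != set0.
  by apply: (osp_neq0 (pi := pi)); exact: mem_nth.
suff -> : nat_of_ord b \in unzip1 (labelled (block_index pi) X) by [].
rewrite /unzip1 -map_comp; apply/mapP; exists k; rewrite ?mem_enum //=.
by apply/esym/eqP; rewrite block_index_nth.
Qed.

Lemma block_cumulant_wcum n (pi : osp n) (X : 'I_n -> A) :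
  block_cumulant S pi X =
  block_wcum expect (size (blocks pi)) (labelled (block_index pi) X).
Proof.
rewrite /block_cumulant (big_nth set0) big_mkord; apply: eq_bigr => b _.
set P := nth _ _ _.
have P0 : (0 < #|P|)%N.
  by rewrite card_gt0; apply: (osp_neq0 (pi := pi)); exact: mem_nth.
rewrite cumulant_wcum //.
have one_blocks m : (0 < m)%N -> blocks (one_osp m) = [:: setT].
  move=> m0; rewrite /= /drop_empty /=; case: ifP => // /negbFE/eqP/setP/(_ (Ordinal m0)).
  by rewrite !inE.
have one_index m (k : 'I_m) : block_index (one_osp m) k = 0%N.
  apply/eqP; rewrite -leqn0 -ltnS.
  by have := block_index_lt (one_osp m) k; rewrite one_blocks // (leq_ltn_trans _ (ltn_ord k)).
pose xs := [seq X k | k <- enum P].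
have -> : labelled (block_index (one_osp #|P|)) (fun j => X (enum_val j)) =
    [seq (0%N, x) | x <- xs].
  rewrite /xs -map_comp; apply: (@eq_from_nth _ (0%N, 0)) => [|j].
    by rewrite size_labelled size_map cardE.
  rewrite size_labelled => jP; rewrite (nth_map (Ordinal jP)) ?size_enum_ord //.
  have k0 := enum_val (Ordinal jP).
  rewrite (nth_map k0) -?cardE //= one_index (enum_val_nth k0) /=.
  by rewrite nth_enum_ord.
rewrite (wcum_one_label expect_relabel expect_nil (p' := size (blocks pi))
  (b' := b)) //; last by rewrite one_blocks.
congr wcum; rewrite /with_label /labelled filter_map /xs -map_comp.
rewrite (_ : enum P = [seq k <- enum 'I_n | block_index pi k == b]); last first.
  by rewrite {1}/enum_mem -enumT; apply: eq_filter => k; rewrite block_index_nth.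
apply/eq_in_map => k; rewrite mem_filter => /andP[/eqP kb _] /=.
by rewrite kb.
Qed.

End WordExpectation.

Arguments expect : simpl never.

(** * Patterns in sequences of labels *)

Section LabelSequences.
Local Open Scope nat_scope.
Implicit Types (s t u : seq nat) (x y l : nat).

Definition interval_seq s : Prop := forall x y, subseq [:: x; y; x] s -> x = y.
Definition monotone_seq s : Prop := forall x y, subseq [:: x; y; x] s -> x <= y.
Definition noncrossing_seq s : Prop := forall x y, subseq [:: x; y; x; y] s -> x = y.

Lemma subseq_skip x t s1 s2 : x \notin s1 ->
  subseq (x :: t) (s1 ++ s2) = subseq (x :: t) s2.
Proof.
elim: s1 => [//|a s1 IHs]; rewrite inE negb_or => /andP[/negPf xa xs].
by rewrite cat_cons [LHS]/= xa -[RHS](IHs xs).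
Qed.

Lemma no_return l y m s1 s2 : l \notin s1 -> l \notin s2 -> y != l ->
  ~~ subseq [:: l; y; l] (s1 ++ nseq m l ++ s2).
Proof.
move=> l1 l2 yl; rewrite subseq_skip //; case: m => [|m].
  by apply: contra l2 => /mem_subseq; apply; rewrite mem_head.
rewrite /= eqxx subseq_skip ?mem_nseq ?negb_and ?yl ?orbT //.
by apply: contra l2 => /mem_subseq; apply; rewrite !inE eqxx orbT.
Qed.

Lemma subseq_avoid l m t s1 s2 : l \notin t ->
  subseq t (s1 ++ nseq m l ++ s2) -> subseq t (s1 ++ s2).
Proof.
move=> lt; have tl : all (predC1 l) t.
  by apply/allP => x xt /=; apply: contraNneq lt => <-.
have E : [seq x <- s1 ++ nseq m l ++ s2 | predC1 l x] = [seq x <- s1 ++ s2 | predC1 l x].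
  by rewrite !filter_cat filter_nseq /= eqxx.
move=> ts; have : subseq t [seq x <- s1 ++ nseq m l ++ s2 | predC1 l x].
  by rewrite subseq_filter tl.
by rewrite E subseq_filter => /andP[].
Qed.

Lemma subseq_remove m l s1 s2 : subseq (s1 ++ s2) (s1 ++ nseq m l ++ s2).
Proof. by rewrite subseq_cat2l; exact: suffix_subseq. Qed.

Lemma interval_seq_peel m l s : l \notin s ->
  interval_seq (nseq m l ++ s) <-> interval_seq s.
Proof.
move=> ls; split=> nice x y sub.
  by apply: nice; apply: subseq_trans sub _; exact: suffix_subseq.
apply/eqP; apply: contraT => xy.
have [xl|xl] := eqVneq x l.
  by subst x; move: (@no_return l y m [::] s isT ls); rewrite eq_sym xy sub => /(_ isT).
have sub' : subseq [:: x; y; x] s.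
  by move: sub; rewrite subseq_skip // mem_nseq negb_and xl orbT.
by move: xy; rewrite (nice x y) ?eqxx.
Qed.

Lemma monotone_seq_peel m l s1 s2 : l \notin s1 -> l \notin s2 ->
  (forall x, x \in s1 ++ s2 -> x <= l) ->
  monotone_seq (s1 ++ nseq m l ++ s2) <-> monotone_seq (s1 ++ s2).
Proof.
move=> l1 l2 lmax; split=> nice x y sub.
  by apply: nice; apply: subseq_trans sub _; exact: subseq_remove.
have [//|xy] := eqVneq x y; first by move=> ->.
have [xl|xl] := eqVneq x l.
  by subst x; move: (no_return m l1 l2 (y := y)); rewrite eq_sym xy sub => /(_ isT).
have [yl|yl] := eqVneq y l.
  subst y; apply: lmax; have /mem_subseq/(_ x) : subseq [:: x] (s1 ++ nseq m l ++ s2).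
    by apply: subseq_trans sub; rewrite sub1seq mem_head.
  by rewrite mem_head !mem_cat mem_nseq (negPf xl) andbF => /(_ isT).
apply: nice; apply: subseq_avoid sub.
by rewrite !inE !negb_or ![l == _]eq_sym xl yl.
Qed.

Lemma noncrossing_seq_peel m l s1 s2 : l \notin s1 -> l \notin s2 ->
  noncrossing_seq (s1 ++ nseq m l ++ s2) <-> noncrossing_seq (s1 ++ s2).
Proof.
move=> l1 l2; split=> nice x y sub.
  by apply: nice; apply: subseq_trans sub _; exact: subseq_remove.
apply/eqP; apply: contraT => xy.
have sub1 : subseq [:: x; y; x] (s1 ++ nseq m l ++ s2).
  by apply: subseq_trans sub; exact: (prefix_subseq [:: x; y; x] [:: y]).
have sub2 : subseq [:: y; x; y] (s1 ++ nseq m l ++ s2).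
  by apply: subseq_trans sub; exact: subseq_cons.
have [xl|xl] := eqVneq x l.
  by subst x; move: (no_return m l1 l2 (y := y)); rewrite eq_sym xy sub1 => /(_ isT).
have [yl|yl] := eqVneq y l.
  by subst y; move: (no_return m l1 l2 (y := x)); rewrite xy sub2 => /(_ isT).
move: xy; rewrite (nice x y) ?eqxx //; apply: subseq_avoid sub.
by rewrite !inE !negb_or ![l == _]eq_sym xl yl.
Qed.

Definition head_sat (P : pred nat) s : bool := if s is x :: _ then P x else true.

Definition last_sat (P : pred nat) s : bool := head_sat P (rev s).

Lemma last_sat_rcons P s x : last_sat P (rcons s x) = P x.
Proof. by rewrite /last_sat rev_rcons. Qed.

Lemma head_sat_cat P s1 s2 : all P s1 -> head_sat P s2 -> head_sat P (s1 ++ s2).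
Proof. by case: s1 => //= x s1 /andP[]. Qed.

Lemma last_sat_cat P s1 s2 : last_sat P s1 -> all P s2 -> last_sat P (s1 ++ s2).
Proof. by move=> h a; rewrite /last_sat rev_cat head_sat_cat ?all_rev. Qed.

Lemma head_sat_all P s : all P s -> head_sat P s.
Proof. by case: s => //= x s /andP[]. Qed.

Lemma last_sat_all P s : all P s -> last_sat P s.
Proof. by move=> a; apply: head_sat_all; rewrite all_rev. Qed.

Lemma initial_run l s : exists m t, s = nseq m l ++ t /\ head_sat (predC1 l) t.
Proof.
elim: s => [|x s [m [t [-> ht]]]]; first by exists 0, [::].
have [->|xl] := eqVneq x l; first by exists m.+1, t.
by exists 0, (x :: nseq m l ++ t).
Qed.

Lemma first_run l s : l \in s -> exists m s1 t,
  [/\ s = s1 ++ nseq m.+1 l ++ t, l \notin s1 & head_sat (predC1 l) t].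
Proof.
elim: s => // x s IHs; rewrite inE; have [<- _|xl /=] := eqVneq l x.
  have [m [t [-> ht]]] := initial_run l s.
  by exists m, [::], t.
move=> /IHs[m [s1 [t [-> ls1 ht]]]]; exists m, (x :: s1), t; split=> //.
by rewrite inE negb_or xl.
Qed.

Lemma return_of_run l m s1 s2 : l \in s2 -> head_sat (predC1 l) s2 ->
  exists y, [/\ y \in s2, y != l & subseq [:: l; y; l] (s1 ++ nseq m.+1 l ++ s2)].
Proof.
case: s2 => // y s2; rewrite inE => /predU1P[->|ls] /= yl; first by rewrite eqxx in yl.
exists y; rewrite mem_head yl; split=> //.
apply: (subseq_trans _ (suffix_subseq _ _)); rewrite /= eqxx.
by apply: (subseq_trans _ (suffix_subseq _ _)); rewrite /= eqxx sub1seq.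
Qed.

(** Start from the first label x.  If x comes back after its first run, the
    labels strictly between the two runs occur nowhere else, for otherwise they
    would cross x; so the argument continues inside that shorter factor. *)
Lemma noncrossing_contiguous s : s != [::] -> noncrossing_seq s ->
  exists2 l, l \in s & forall y, y != l -> ~~ subseq [:: l; y; l] s.
Proof.
suff H n u s1 s2 : size u <= n -> u != [::] ->
    (forall x, x \in u -> x \notin s1 ++ s2) -> noncrossing_seq (s1 ++ u ++ s2) ->
    exists2 l, l \in u & forall y, y != l -> ~~ subseq [:: l; y; l] (s1 ++ u ++ s2).
  move=> s0 nc; have nc0 : noncrossing_seq ([::] ++ s ++ [::]) by rewrite cats0.
  have [l ls lE] := H _ s [::] [::] (leqnn _) s0 (fun _ _ => isT) nc0.
  by exists l => //; move: lE; rewrite cats0.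
elim: n u s1 s2 => [|n IHn] [//|x u] s1 s2 //; rewrite [size _]/= ltnS => un _ uE nc.
have [m [t [uxE ht]]] := initial_run x u.
have [x1 x2] : x \notin s1 /\ x \notin s2.
  by have := uE x (mem_head _ _); rewrite mem_cat negb_or => /andP[].
have [xt|xt] := boolP (x \in t); last first.
  exists x => [|y yx]; first exact: mem_head.
  rewrite uxE -cat_cons -catA -[x :: nseq m x]/(nseq m.+1 x); apply: no_return => //.
  by rewrite mem_cat negb_or xt.
have [k [u1 [t' [tE xu1 _]]]] := first_run xt.
have u10 : u1 != [::].
  by case: u1 tE xu1 {IHn} => // tE _; move: ht; rewrite tE /= eqxx.
pose t2 := nseq k.+1 x ++ t'.
have sE : s1 ++ (x :: u) ++ s2 = (s1 ++ nseq m.+1 x) ++ u1 ++ t2 ++ s2.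
  by rewrite uxE tE /t2 -cat_cons -[x :: nseq m x]/(nseq m.+1 x) -!catA.
rewrite sE in nc *.
have u1u z : z \in u1 -> z \in x :: u.
  by move=> zu; rewrite inE uxE tE !mem_cat zu !orbT.
have u1n : size u1 <= n.
  by apply: leq_trans un; rewrite uxE tE !size_cat addnCA leq_addr.
have u1E z : z \in u1 -> z \notin (s1 ++ nseq m.+1 x) ++ t2 ++ s2.
  move=> zu; have zx : z != x by apply: contraNneq xu1 => <-.
  have znx k' : (z \in nseq k' x) = false by rewrite mem_nseq (negPf zx) andbF.
  have := uE z (u1u z zu); rewrite mem_cat negb_or => /andP[z1 z2].
  rewrite 3!mem_cat znx (negPf z1) (negPf z2) orbF /=; apply/negP => zt.
  case/eqP: zx; apply/esym/nc; rewrite -[[:: x; z; x; z]]/([:: x] ++ [:: z] ++ [:: x; z]).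
  apply: cat_subseq; first by rewrite sub1seq mem_cat mem_nseq eqxx orbT.
  apply: cat_subseq; first by rewrite sub1seq.
  apply: (subseq_trans _ (prefix_subseq _ _)); rewrite /t2 /= eqxx sub1seq.
  by move: zt; rewrite orbF /t2 mem_cat znx /= => zt; rewrite mem_cat zt orbT.
have [l lu lE] := IHn u1 _ _ u1n u10 u1E nc.
by exists l => //; exact: u1u.
Qed.

End LabelSequences.

(** * Splitting words into runs *)

Section WordRuns.
Variable A : eqType.
Implicit Types (w v r : seq (nat * A)).

Lemma unzip1_cat w s1 s2 : unzip1 w = s1 ++ s2 ->
  exists w1 w2, [/\ w = w1 ++ w2, unzip1 w1 = s1 & unzip1 w2 = s2].
Proof.
move=> wE; exists (take (size s1) w), (drop (size s1) w).
by rewrite cat_take_drop /unzip1 map_take map_drop -/(unzip1 w) wE take_size_cat // drop_size_cat.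
Qed.

Lemma choices_all2 I w v : v \in choices I w ->
  all2 (fun j l => j \in I l) (unzip1 v) (unzip1 w).
Proof.
elim: w v => [|[l x] w IHw] v; first by rewrite inE => /eqP->.
by move=> /allpairsP[[j v'] /= [jI v'I ->]] /=; rewrite jI IHw.
Qed.

Lemma all2_head_sat (I : nat -> seq nat) (P Q : pred nat) s t :
  (forall l j, P l -> j \in I l -> Q j) ->
  all2 (fun j l => j \in I l) s t -> head_sat P t -> head_sat Q s.
Proof. by move=> PQ; case: s t => [|j s] [|l t] //= /andP[jI _] /PQ; apply. Qed.

Lemma all2_rev (T1 T2 : Type) (R : T1 -> T2 -> bool) s t :
  all2 R s t -> all2 R (rev s) (rev t).
Proof.
by rewrite !all2E !size_rev => /andP[/eqP st a]; rewrite st eqxx -rev_zip // all_rev.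
Qed.

Lemma choices_head_sat (I : nat -> seq nat) (P Q : pred nat) w v :
  (forall l j, P l -> j \in I l -> Q j) ->
  v \in choices I w -> head_sat P (unzip1 w) -> head_sat Q (unzip1 v).
Proof. by move=> PQ /choices_all2; exact: all2_head_sat. Qed.

Lemma choices_last_sat (I : nat -> seq nat) (P Q : pred nat) w v :
  (forall l j, P l -> j \in I l -> Q j) ->
  v \in choices I w -> last_sat P (unzip1 w) -> last_sat Q (unzip1 v).
Proof. by move=> PQ /choices_all2/all2_rev; exact: all2_head_sat. Qed.

Lemma with_label_const r l b : unzip1 r = nseq (size r) l ->
  with_label b r = if b == l then r else [::].
Proof.
elim: r => [|[k x] r IHr] /=; first by rewrite if_same.
by move=> [-> /IHr ->]; rewrite eq_sym; case: eqP.
Qed.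

Lemma with_label_notin w b : b \notin unzip1 w -> with_label b w = [::].
Proof. by rewrite mem_labels negbK => /eqP. Qed.

End WordRuns.

Section Peeling.
Variables (C : numFieldType) (A : eqType) (E : seq (nat * A) -> C).
Implicit Types (w v r : seq (nat * A)).

(** A factorization of every expansion sums up to a factorization of [dot],
    since the choices in the three parts are independent. *)
Lemma dot_run N w1 r w2 :
  (forall v1 vr v2, v1 \in choices (stack N) w1 -> vr \in choices (stack N) r ->
     v2 \in choices (stack N) w2 -> E (v1 ++ vr ++ v2) = E vr * E (v1 ++ v2)) ->
  dot E N (w1 ++ r ++ w2) = dot E N r * dot E N (w1 ++ w2).
Proof.
move=> fac; rewrite /dot !sum_choices_cat.
under eq_bigr => v1 _ do rewrite sum_choices_cat.
rewrite exchange_big /= big_distrl /=; apply: eq_big_seq => vr vrI.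
rewrite big_distrr /=; apply: eq_big_seq => v1 v1I.
by rewrite big_distrr /=; apply: eq_big_seq => v2 v2I; exact: fac.
Qed.

Lemma peelable_run (nice : seq nat -> Prop) w1 r w2 l :
  (0 < size r)%N -> unzip1 r = nseq (size r) l ->
  l \notin unzip1 w1 -> l \notin unzip1 w2 ->
  (forall N, dot E N (w1 ++ r ++ w2) = dot E N r * dot E N (w1 ++ w2)) ->
  (nice (unzip1 w1 ++ unzip1 r ++ unzip1 w2) <-> nice (unzip1 w1 ++ unzip1 w2)) ->
  peelable E nice (w1 ++ r ++ w2).
Proof.
move=> r0 rl l1 l2 dE nE; exists r, (w1 ++ w2), l; split; split=> //.
- by rewrite !size_cat addnCA.
- move=> b; rewrite /with_label !filter_cat -!/(with_label _ _) (with_label_const _ rl).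
  by case: eqP => [->|//]; rewrite !with_label_notin // cats0.
- by rewrite /unzip1 map_cat mem_cat negb_or l1.
- by rewrite /unzip1 !map_cat.
Qed.

End Peeling.

(** * Boolean independence *)

Section NonunitalWords.
Variables (C : numFieldType) (A U : nuAlgType C) (phi : {scalar A}).
Variable S : spreadability_system U phi.
Implicit Types (w v r : seq (nat * A)).
Local Notation E := (expect S).

Lemma nuprod_merge (B : nuAlgType C) (x y : B) s t :
  nuprod (s ++ x :: y :: t) = nuprod (s ++ numul x y :: t).
Proof. by case: s => [//|z s] /=; rewrite !foldl_cat /= numulA. Qed.

Lemma expect_merge j x y v1 v2 :
  E (v1 ++ (j, x) :: (j, y) :: v2) = E (v1 ++ (j, numul x y) :: v2).
Proof.
rewrite !expectE; try by case: v1.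
by rewrite /word !map_cat /= nuprod_merge (ss_iotaM S).
Qed.

End NonunitalWords.

Section Boolean.
Variables (C : numFieldType) (A U : nuAlgType C) (phi : {scalar A}).
Variable S : spreadability_system U phi.
Hypothesis bS : boolean_system S.
Implicit Types (w v r : seq (nat * A)).
Local Notation E := (expect S).

(** Normal form under the multiplication of adjacent letters of equal index; the
    rule that defines the Boolean functional speaks of alternating words only. *)
Fixpoint merge_word v : seq (nat * A) :=
  if v is (i, x) :: v' then
    match merge_word v' with
    | (j, y) :: u => if i == j then (i, numul x y) :: u else (i, x) :: (j, y) :: u
    | [::] => [:: (i, x)]
    end
  else [::].

Lemma merge_word_head P v : head_sat P (unzip1 (merge_word v)) = head_sat P (unzip1 v).
Proof. by case: v => //= -[i x] v; case: merge_word => //= -[j y] u; case: eqP. Qed.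

Lemma merge_word_alternating v : alternating (merge_word v).
Proof.
elim: v => //= -[i x] v; case: merge_word => //= -[j y] u; case: eqP => //= [->|/eqP ->//].
by case: u.
Qed.

Lemma expect_merge_word v1 v : E (v1 ++ merge_word v) = E (v1 ++ v).
Proof.
elim: v v1 => //= -[i x] v IHv v1; rewrite -cat_rcons -IHv cat_rcons.
case: merge_word => //= -[j y] u; case: eqP => // <-.
by rewrite expect_merge.
Qed.

Lemma expect_boolean v : E v = \prod_(a <- merge_word v) phi a.2.
Proof.
rewrite -[LHS](expect_merge_word [::]) /=; have := merge_word_alternating v.
case: merge_word => [|a u] alt; first by rewrite big_nil.
by rewrite expectE //; apply: bS.2.
Qed.

Lemma merge_word_cat (P : pred nat) v1 v2 : all P (unzip1 v1) ->
  head_sat (predC P) (unzip1 v2) -> merge_word (v1 ++ v2) = merge_word v1 ++ merge_word v2.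
Proof.
move=> + h2; elim: v1 => //= -[i x] v1 IHv /= /andP[Pi P1]; rewrite {}IHv //.
case E1: merge_word => [|[j y] u] /=; last by case: eqP.
move: h2; rewrite -merge_word_head; case: merge_word => //= -[j y] u /= Pj.
by case: eqP => // ij; rewrite -ij Pi in Pj.
Qed.

(** The last index of v1 and the first one of v2 differ, so that merging does
    not act across the boundary. *)
Lemma expect_boolean_cat (P : pred nat) v1 v2 : all P (unzip1 v1) ->
  head_sat (predC P) (unzip1 v2) -> E (v1 ++ v2) = E v1 * E v2.
Proof. by move=> P1 P2; rewrite !expect_boolean (merge_word_cat P1 P2) big_cat. Qed.

(** The initial run r satisfies E (r ++ w2) = E r * E w2. *)
Theorem boolean_wcum p w : all (gtn p) (unzip1 w) ->
  (interval_seq (unzip1 w) -> wcum E p w = block_wcum E p w) /\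
  (~ interval_seq (unzip1 w) -> wcum E p w = 0).
Proof.
apply: wcum_factorization => //; first exact: expect_relabel.
move=> {}w w0 wp; case wE: (unzip1 w) w0 => [|l s] w0.
  by case: w wE w0 {wp}.
have [m [t [sE ht]]] := initial_run l s.
have [r [w2 [wE' rE w2E]]] : exists r w2,
    [/\ w = r ++ w2, unzip1 r = nseq m.+1 l & unzip1 w2 = t].
  by apply: unzip1_cat; rewrite wE sE.
have sr : size r = m.+1 by rewrite -(size_map fst) -/(unzip1 r) rE size_nseq.
have dE N : dot E N w = dot E N r * dot E N w2.
  rewrite wE' -[LHS](_ : dot E N ([::] ++ r ++ w2) = _) //; apply: dot_run => v1 vr v2.
  rewrite inE => /eqP-> vrI v2I /=.
  apply: (@expect_boolean_cat (mem (stack N l))).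
    apply: (choices_all (P := pred1 l)) vrI => [k j /eqP -> //|].
    by rewrite rE all_nseq /= eqxx.
  apply: (choices_head_sat (P := predC1 l)) v2I _; last by rewrite w2E.
  by move=> k j /= kl jk; apply: contra kl => /(stack_inj jk) ->.
have r0 : (0 < size r)%N by rewrite sr.
rewrite /= in wE'; have [lt|lt] := boolP (l \in t); [right|left].
  split.
    apply: (wcum_eq0 (expect_relabel S) (w' := w2) (r := r) (b := l)) dE => //.
    - by move: wp; rewrite wE' /unzip1 map_cat all_cat => /andP[].
    - by move: wp; rewrite wE' /unzip1 map_cat all_cat => /andP[].
    - by rewrite rE mem_head.
    - by rewrite w2E.
  rewrite sE; have [y [_ yl sub]] := return_of_run m [::] lt ht.
  by move=> /(_ l y sub) ly; rewrite ly eqxx in yl.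
rewrite wE' -[r ++ w2]cat0s; apply: (@peelable_run _ _ _ _ _ _ _ l) => //=.
- by rewrite rE sr.
- by rewrite w2E.
- by move=> N; rewrite -wE'.
- by rewrite rE w2E; exact: interval_seq_peel.
Qed.

End Boolean.

(** * Monotone independence *)

Section Monotone.
Variables (C : numFieldType) (A U : nuAlgType C) (phi : {scalar A}).
Variable S : spreadability_system U phi.
Hypothesis mS : monotone_system S.
Implicit Types (w v r : seq (nat * A)).
Local Notation E := (expect S).

(** The four recursion rules, at the left end, at the right end, in the
    middle, and for a single letter, say the same thing once the empty word has
    expectation 1. *)
Lemma expect_peak (m : nat) x v1 v2 :
  last_sat (gtn m) (unzip1 v1) -> head_sat (gtn m) (unzip1 v2) ->
  E (v1 ++ (m, x) :: v2) = phi x * E (v1 ++ v2).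
Proof.
have [_ m1 mf ml mp] := mS.
case/lastP: v1 => [_|v1 [i z]].
  case: v2 => [_|[k y] v2 /= km]; first by rewrite /= expect_cons m1 expect_nil mulr1.
  by rewrite !expectE //; exact: mf.
rewrite /unzip1 map_rcons last_sat_rcons /= => im.
case: v2 => [_|[k y] v2 /= km].
  rewrite cats0 -cats1 -catA /= mulrC !expectE; try by case: v1.
  exact: ml.
rewrite mulrC !cat_rcons !expectE; try by case: v1.
exact: mp.
Qed.

Lemma max_split r : r != [::] -> exists r1 m x r2,
  [/\ r = r1 ++ (m, x) :: r2, all (gtn m) (unzip1 r1) & all (geq m) (unzip1 r2)].
Proof.
elim: r => // -[j y] r IHr _; have [->|r0] := eqVneq r [::].
  by exists [::], j, y, [::].
have [r1 [m [x [r2 [-> lt1 le2]]]]] := IHr r0.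
have [jm|mj] := ltnP j m.
  by exists ((j, y) :: r1), m, x, r2; split=> //=; rewrite jm.
exists [::], j, y, (r1 ++ (m, x) :: r2); split=> //.
rewrite /unzip1 map_cat all_cat /= mj; apply/andP; split.
  by apply: sub_all lt1 => k /= km; rewrite ltnW // (leq_trans km).
by apply: sub_all le2 => k /= km; rewrite (leq_trans km).
Qed.

(** The first largest index of r is either followed by itself, and then the two
    letters are merged, or it is a peak both in r and in the whole word, and
    then its letter is removed from both sides. *)
Lemma expect_monotone_run v1 r v2 :
  (forall j, j \in unzip1 r -> last_sat (gtn j) (unzip1 v1)) ->
  (forall j, j \in unzip1 r -> head_sat (gtn j) (unzip1 v2)) ->
  E (v1 ++ r ++ v2) = E r * E (v1 ++ v2).
Proof.
have [n] := ubnP (size r); elim: n r => // n IHn r; rewrite ltnS => rn lo hi.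
have [->|r0] := eqVneq r [::]; first by rewrite mul1r.
have [r1 [m [x [r2 [rE lt1 le2]]]]] := max_split r0.
have mr : m \in unzip1 r by rewrite rE /unzip1 map_cat mem_cat mem_head orbT.
case: r2 rE le2 => [|[j y] r2] rE le2.
  have lt0 : last_sat (gtn m) (unzip1 (v1 ++ r1)).
    by rewrite /unzip1 map_cat; apply: last_sat_cat => //; exact: lo.
  rewrite {1}rE -catA /= catA expect_peak //; last exact: hi.
  rewrite -catA IHn; first by rewrite mulrA rE (expect_peak x (last_sat_all lt1)) // cats0.
  - by apply: leq_trans rn; rewrite rE size_cat addn1.
  - by move=> k kr; apply: lo; rewrite rE /unzip1 map_cat mem_cat kr.
  - by move=> k kr; apply: hi; rewrite rE /unzip1 map_cat mem_cat kr.
move: le2; rewrite /= => /andP[]; rewrite leq_eqVlt => /predU1P[jm|jm] le2.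
  subst j; have sub k : k \in unzip1 (r1 ++ (m, numul x y) :: r2) -> k \in unzip1 r.
    rewrite rE /unzip1 !map_cat !mem_cat !inE => /or3P[->|->|->]; by rewrite ?orbT.
  rewrite {2}rE expect_merge -IHn.
  - by rewrite rE -!catA /= catA expect_merge -catA.
  - by apply: leq_trans rn; rewrite rE !size_cat /= !addnS.
  - by move=> k /sub; exact: lo.
  - by move=> k /sub; exact: hi.
have lt0 : last_sat (gtn m) (unzip1 (v1 ++ r1)).
  by rewrite /unzip1 map_cat; apply: last_sat_cat => //; exact: lo.
have sub k : k \in unzip1 (r1 ++ (j, y) :: r2) -> k \in unzip1 r.
  rewrite rE /unzip1 !map_cat !mem_cat !inE => /or3P[->|->|->]; by rewrite ?orbT.
rewrite {1}rE -catA /= catA expect_peak // -catA -[_ :: r2 ++ v2]cat_cons catA -catA.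
rewrite (catA r1) IHn.
- by rewrite mulrA rE (expect_peak x (last_sat_all lt1)).
- by apply: leq_trans rn; rewrite rE !size_cat /= !addnS.
- by move=> k /sub; exact: lo.
- by move=> k /sub; exact: hi.
Qed.

(** The first run of the largest label is higher than both of its
    neighbours. *)
Theorem monotone_wcum p w : all (gtn p) (unzip1 w) ->
  (monotone_seq (unzip1 w) -> wcum E p w = block_wcum E p w) /\
  (~ monotone_seq (unzip1 w) -> wcum E p w = 0).
Proof.
apply: wcum_factorization => //; first exact: expect_relabel.
move=> {}w w0 wp; have [l lw lmax] : exists2 l, l \in unzip1 w &
    forall k, k \in unzip1 w -> (k <= l)%N.
  have [r1 [m [x [r2 [-> lt1 le2]]]]] := max_split w0; exists m.
    by rewrite /unzip1 map_cat mem_cat mem_head orbT.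
  move=> k; rewrite /unzip1 map_cat mem_cat inE => /or3P[/(allP lt1)/ltnW //|/eqP -> //|].
  exact: (allP le2).
have [m [s1 [s2 [wE ls1 hs2]]]] := first_run lw.
have [w1 [t [wE1 w1E tE]]] := unzip1_cat wE.
have [r [w2 [tE' rE w2E]]] := unzip1_cat tE.
subst t w; have sr : size r = m.+1 by rewrite -(size_map fst) -/(unzip1 r) rE size_nseq.
have below_l (k j1 j2 : nat) N : k \in unzip1 (w1 ++ r ++ w2) -> k != l ->
    j1 \in stack N k -> j2 \in stack N l -> (j1 < j2)%N.
  by move=> kw kl; apply: stack_lt; rewrite ltn_neqAle kl lmax.
have dE N : dot E N (w1 ++ r ++ w2) = dot E N r * dot E N (w1 ++ w2).
  apply: dot_run => v1 vr v2 v1I vrI v2I.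
  have vrl j : j \in unzip1 vr -> j \in stack N l.
    apply: allP; apply: (choices_all (P := pred1 l)) vrI => [k i /eqP -> //|].
    by rewrite rE all_nseq /= eqxx.
  apply: expect_monotone_run => j /vrl jl.
    apply: (choices_last_sat (P := fun k => (k != l) && (k \in unzip1 (w1 ++ r ++ w2)))) v1I _.
      by move=> k i /andP[kl kw] ik; exact: below_l ik jl.
    apply: last_sat_all; apply/allP => k kw1; rewrite /unzip1 map_cat mem_cat kw1 andbT.
    by apply: contraNneq ls1 => <-; rewrite -w1E.
  apply: (choices_head_sat (P := fun k => (k != l) && (k \in unzip1 (w1 ++ r ++ w2)))) v2I _.
    by move=> k i /andP[kl kw] ik; exact: below_l ik jl.
  have sub : {subset s2 <= unzip1 (w1 ++ r ++ w2)}.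
    by move=> k ks; rewrite wE !mem_cat ks !orbT.
  rewrite w2E; case: (s2) hs2 sub => //= k s kl sub.
  by rewrite sub ?mem_head ?andbT.
have r0 : (0 < size r)%N by rewrite sr.
have [lt|lt] := boolP (l \in s2); [right|left].
  split.
    apply: (wcum_eq0 (expect_relabel S) (w' := w1 ++ w2) (r := r) (b := l)) dE => //.
    - by move: wp; rewrite /unzip1 !map_cat !all_cat => /and3P[].
    - by move: wp; rewrite /unzip1 !map_cat !all_cat => /and3P[-> _ ->].
    - by rewrite rE mem_head.
    - by rewrite /unzip1 map_cat mem_cat -!/(unzip1 _) w2E lt orbT.
  rewrite wE; have [y [ys2 yl sub]] := return_of_run m s1 lt hs2.
  move=> /(_ l y sub) ly; case/eqP: yl; apply/eqP; rewrite eqn_leq ly lmax //.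
  by rewrite wE !mem_cat ys2 !orbT.
apply: (@peelable_run _ _ _ _ _ _ _ l) => //=.
- by rewrite rE sr.
- by rewrite w1E.
- by rewrite w2E.
- rewrite rE w2E w1E; apply: monotone_seq_peel => // k.
  rewrite mem_cat => ks; apply: lmax; rewrite wE !mem_cat.
  by case/orP: ks => ->; rewrite ?orbT.
Qed.

End Monotone.

(** * Tensor independence *)

Section UnitalWords.
Variables (C : numFieldType) (A U : algType C) (phi : {scalar A}).
Variable S : spreadability_system U phi.
Implicit Types (w v r : seq (nat * A)).

Lemma nuprod_prod (B : algType C) (x : B) s : nuprod (x :: s) = \prod_(y <- x :: s) y.
Proof.
rewrite /= big_cons; elim: s x => [|y s IHs] x /=; first by rewrite big_nil mulr1.
by rewrite IHs big_cons mulrA.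
Qed.

Definition mword v : U := \prod_(a <- v) ss_iota S a.1 a.2.

Lemma expect_mword v : ss_phi S 1 = 1 -> expect S v = ss_phi S (mword v).
Proof.
case: v => [|a v] phi1; first by rewrite /mword big_nil phi1.
by rewrite expect_cons /word map_cons nuprod_prod big_cons big_map /mword big_cons.
Qed.

Lemma mword_cat v1 v2 : mword (v1 ++ v2) = mword v1 * mword v2.
Proof. by rewrite /mword big_cat. Qed.

Lemma mword_cons i a v : mword ((i, a) :: v) = ss_iota S i a * mword v.
Proof. by rewrite /mword big_cons. Qed.

End UnitalWords.

Section Tensor.
Variables (C : numFieldType) (A U : algType C) (phi : {scalar A}).
Variable S : spreadability_system U phi.
Hypothesis phi1 : phi 1 = 1.
Hypothesis tS : tensor_system S.
Implicit Types (w v r : seq (nat * A)).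
Local Notation E := (expect S).

(** The j-th leg of the elementary tensor that the word represents. *)
Definition leg (j : nat) v : A :=
  foldr (fun (a : nat * A) z => if a.1 == j then a.2 * z else z) 1 v.

Lemma leg_notin j v : j \notin unzip1 v -> leg j v = 1.
Proof.
elim: v => //= -[i a] v IHv; rewrite inE negb_or eq_sym => /andP[/negPf -> /IHv ->].
by [].
Qed.

Lemma leg_filter j v (P : pred nat) :
  leg j [seq a <- v | P a.1] = if P j then leg j v else 1.
Proof.
elim: v => [|[i a] v IHv] /=; first by rewrite if_same.
case: ifP => Pi /=; rewrite IHv; case: eqP => [<-|//]; rewrite Pi //.
Qed.

Lemma leg_bound v : exists n, forall m, (n <= m)%N -> leg m v = 1.
Proof.
exists (\max_(k <- unzip1 v) k).+1 => m nm; apply: leg_notin.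
by apply/negP => mv; move: nm; rewrite ltnNge leq_bigmax_seq.
Qed.

Lemma expect_tensor v n : (forall m, (n <= m)%N -> leg m v = 1) ->
  E v = \prod_(j < n) phi (leg j v).
Proof.
have [t [[_ _ t1 tM] iotaE phiE]] := tS.
have sphi1 : ss_phi S 1 = 1 by rewrite -t1 (phiE _ 0%N) // big_ord0.
move=> nv; rewrite expect_mword // -(phiE (leg^~ v)) //; congr (ss_phi S _).
elim: v {n nv} => [|[i a] v IHv]; first by rewrite /mword big_nil -t1.
rewrite mword_cons iotaE IHv -tM.
- congr t; apply: boolp.funext => j; rewrite /upd /= eq_sym.
  by case: eqP; rewrite ?mul1r.
- by exists i.+1 => j ij; rewrite /upd gtn_eqF.
- exact: leg_bound.
Qed.

(** Each tensor leg is built from letters of one of the two sub-words only. *)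
Lemma expect_tensor_filter (P : pred nat) v :
  E v = E [seq a <- v | P a.1] * E [seq a <- v | ~~ P a.1].
Proof.
have [n nv] := leg_bound v.
rewrite (expect_tensor nv) (@expect_tensor [seq a <- v | P a.1] n); last first.
  by move=> m nm; rewrite leg_filter nv // if_same.
rewrite (@expect_tensor [seq a <- v | ~~ P a.1] n); last first.
  by move=> m nm; rewrite (leg_filter m v (predC P)) nv // if_same.
rewrite -big_split; apply: eq_bigr => j _ /=.
rewrite leg_filter (leg_filter j v (predC P)) /=.
by case: (P j); rewrite /= phi1 ?mulr1 ?mul1r.
Qed.

Theorem tensor_wcum p w : all (gtn p) (unzip1 w) -> wcum E p w = block_wcum E p w.
Proof.
move=> wp; suff [H _] : (True -> wcum E p w = block_wcum E p w) /\
    (~ True -> wcum E p w = 0).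
  exact: H.
apply: (@wcum_factorization _ _ _ (expect_relabel S) (expect_nil S) p (fun=> True)) wp => //.
move=> {}w w0 wp; left; case wE: w w0 => [//|[l x] w'] _; rewrite -wE.
have lr : with_label l w = (l, x) :: with_label l w' by rewrite wE /with_label /= eqxx.
exists (with_label l w), [seq a <- w | a.1 != l], l; split; split=> //.
- by rewrite lr.
- rewrite /with_label; elim: (w) => //= -[k y] u IHu /=.
  by case: eqP => //= ->; rewrite IHu.
- by rewrite !size_filter count_predC.
- move=> b; rewrite /with_label -filter_predI; case: eqP => [-> //|bl].
  apply: eq_filter => a /=; case: eqP => //= ->; apply/esym/eqP => //.
- rewrite mem_labels negbK /with_label -filter_predI.
  rewrite (@eq_filter _ _ pred0) ?filter_pred0 // => a /=.
  by case: eqP.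
- move=> N; rewrite /dot -(@sum_choices_filter _ _ _ (pred1 l) (mem (stack N l))).
    by apply: eq_bigr => v _; rewrite -expect_tensor_filter.
  move=> k j _ jk /=; apply/idP/eqP => [/(stack_inj jk) //|<-//].
Qed.

End Tensor.

(** * Free independence *)

Section Free.
Variables (C : numFieldType) (A U : algType C) (phi : {scalar A}).
Variable S : spreadability_system U phi.
Hypothesis phi1 : phi 1 = 1.
Hypothesis fS : free_system S.
Implicit Types (w v r : seq (nat * A)) (K : seq nat -> bool) (P Q : pred nat) (z : U).
Local Notation E := (expect S).
Local Notation W := (mword S).

Let sphi1 : ss_phi S 1 = 1. Proof. by case: fS. Qed.
Let EW v : E v = ss_phi S (W v). Proof. exact: expect_mword. Qed.

Definition centred v : bool := alternating v && all (fun a => phi a.2 == 0) v.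

(** K constrains the indices of the words: products need control over all the
    indices of the left factor, but only over the first index of the right one. *)
Inductive centred_span K : U -> Prop :=
| centred_span0 : centred_span K 0
| centred_spanD c v z : v != [::] -> centred v -> K (unzip1 v) ->
    centred_span K z -> centred_span K (c *: W v + z).

Lemma centred_span_word K v : v != [::] -> centred v -> K (unzip1 v) -> centred_span K (W v).
Proof.
move=> v0 vc Kv; rewrite -[W v]scale1r -[_ *: _]addr0.
exact/centred_spanD/centred_span0.
Qed.

Lemma centred_span_add K z1 z2 :
  centred_span K z1 -> centred_span K z2 -> centred_span K (z1 + z2).
Proof.
move=> h1 h2; elim: h1 => [|c v z v0 vc Kv _ IH]; first by rewrite add0r.
by rewrite -addrA; apply: centred_spanD.
Qed.

Lemma centred_span_scale K c z : centred_span K z -> centred_span K (c *: z).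
Proof.
elim=> [|d v z' v0 vc Kv _ IH]; first by rewrite scaler0; exact: centred_span0.
by rewrite scalerDr scalerA; apply: centred_spanD.
Qed.

Lemma centred_spanW K K' z : (forall s, K s -> K' s) ->
  centred_span K z -> centred_span K' z.
Proof.
move=> KK'; elim=> [|c v z' v0 vc Kv _ IH]; first exact: centred_span0.
by apply: centred_spanD => //; exact: KK'.
Qed.

Lemma phi_centred_span K z : centred_span K z -> ss_phi S z = 0.
Proof.
have [_ _ alt0] := fS; elim=> [|c v z' v0 /andP[va /allP vc] _ _ IH]; first by rewrite linear0.
rewrite linearD linearZ IH addr0 /= -EW expectE // alt0 ?mulr0 // => a av.
exact/eqP/vc.
Qed.

(** The indices of the left words avoid Q and the right words begin in Q, so
    the concatenations are again alternating. *)
Lemma centred_span_mul P Q z1 z2 : (forall i, P i -> ~~ Q i) ->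
  centred_span (all P) z1 -> centred_span (head_sat Q) z2 ->
  centred_span (head_sat P) (z1 * z2).
Proof.
move=> PQ; elim=> [|c v z v0 /andP[va vc] Pv _ IH] h2.
  by rewrite mul0r; exact: centred_span0.
rewrite mulrDl -scalerAl; apply: centred_span_add; last exact: IH.
apply: centred_span_scale; elim: h2 => [|d u y u0 /andP[ua uc] Qu _ IHu].
  by rewrite mulr0; exact: centred_span0.
rewrite mulrDr -scalerAr -mword_cat; apply: centred_spanD => //.
- by case: (v) v0.
- rewrite /centred all_cat vc uc !andbT /alternating.
  case: v v0 va Pv {vc IH IHu} => // a v _ va /= Pv.
  case: u u0 ua Qu {uc} => // b u _ ua /= Qu.
  move: va ua; rewrite /alternating /= cat_path /= => -> ->; rewrite andbT /=.
  have : P (last a v).1.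
    by rewrite -(last_map fst); apply: (allP (Pv : all P (a.1 :: map fst v))); exact: mem_last.
  by move/PQ; apply: contraNneq => ->.
- by case: v v0 Pv {va vc IH IHu} => // a v _ /= /andP[].
Qed.

Definition mod_scalar_span P z : Prop := exists c, centred_span (all P) (z - c *: 1).

Lemma mod_scalar_span_add P z1 z2 :
  mod_scalar_span P z1 -> mod_scalar_span P z2 -> mod_scalar_span P (z1 + z2).
Proof.
move=> [c1 h1] [c2 h2]; exists (c1 + c2).
rewrite scalerDl opprD addrACA; exact: centred_span_add.
Qed.

Lemma mod_scalar_span_scale P c z : mod_scalar_span P z -> mod_scalar_span P (c *: z).
Proof.
move=> [d h]; exists (c * d); rewrite -scalerA -scalerBr; exact: centred_span_scale.
Qed.

Lemma mod_scalar_span_word P v : centred v -> all P (unzip1 v) -> mod_scalar_span P (W v).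
Proof.
case: v => [|a v] vc Pv.
  by exists 1; rewrite /mword big_nil scale1r subrr; exact: centred_span0.
by exists 0; rewrite scale0r subr0; exact: centred_span_word.
Qed.

Lemma iota_centre i a : ss_iota S i a = phi a *: 1 + ss_iota S i (a - phi a *: 1).
Proof.
have [[iota1 _] _ _] := fS.
by rewrite linearB linearZ /= iota1 addrC subrK.
Qed.

Lemma phi_centre a : phi (a - phi a *: 1) = 0.
Proof. by rewrite linearB linearZ /= phi1 mulr1 subrr. Qed.

(** Split the first letter into its mean and its centred part, after having
    multiplied it with the next letter if the indices agree. *)
Lemma mod_scalar_span_centred_mul P i a v : P i -> centred v -> all P (unzip1 v) ->
  mod_scalar_span P (ss_iota S i a * W v).
Proof.
(* When the next letter has another index, centring the first one yields an
   alternating word. *)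
have conses b u : P i -> centred u -> all P (unzip1 u) -> head_sat (predC1 i) (unzip1 u) ->
    mod_scalar_span P (ss_iota S i b * W u).
  move=> Pi uc Pu hu; rewrite iota_centre mulrDl -scalerAl mul1r.
  apply: mod_scalar_span_add; first exact/mod_scalar_span_scale/mod_scalar_span_word.
  rewrite -mword_cons; apply: mod_scalar_span_word; last by rewrite /= Pi.
  move: uc; rewrite /centred /= phi_centre eqxx /= => /andP[ua ->]; rewrite andbT.
  case: u ua hu {Pu} => //= -[j y] u /= ua ji.
  by rewrite /alternating /= eq_sym ji.
move=> Pi vc Pv; case: v vc Pv => [|[j y] v] vc Pv; first exact: conses.
have [ji|ji] := eqVneq j i; last exact: conses.
subst j; rewrite mword_cons mulrA -(ss_iotaM S i a y : _ = ss_iota S i a * ss_iota S i y).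
move: vc Pv => /andP[va /= /andP[_ vc]] /andP[_ Pv].
apply: conses => //; move: va; rewrite /alternating /=.
  by rewrite /centred vc andbT => /path_sorted.
by case: v {vc Pv} => //= -[k x] v /= /andP[]; rewrite eq_sym.
Qed.

Lemma mod_scalar_span_mul P i a z : P i -> mod_scalar_span P z ->
  mod_scalar_span P (ss_iota S i a * z).
Proof.
move=> Pi [c h]; rewrite -[z](subrK (c *: 1)) mulrDr; apply: mod_scalar_span_add; last first.
  rewrite -scalerAr; apply: mod_scalar_span_scale.
  rewrite (_ : 1 = W [::]); last by rewrite /mword big_nil.
  exact: mod_scalar_span_centred_mul.
elim: h => [|d v y v0 vc Pv _ IH].
  by rewrite mulr0; exists 0; rewrite scale0r subr0; exact: centred_span0.
rewrite mulrDr -scalerAr; apply: mod_scalar_span_add => //.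
exact/mod_scalar_span_scale/mod_scalar_span_centred_mul.
Qed.

(** A word differs from a scalar by a combination of alternating centred
    words, and that scalar is its expectation since such combinations have
    expectation 0. *)
Lemma centred_span_decomp P v : all P (unzip1 v) -> centred_span (all P) (W v - E v *: 1).
Proof.
move=> Pv; have [c h] : mod_scalar_span P (W v).
  elim: v Pv => [_|[i a] v IHv /= /andP[Pi Pv]]; first exact: mod_scalar_span_word.
  by rewrite mword_cons; apply: mod_scalar_span_mul => //; exact: IHv.
suff -> : E v = c by [].
have := phi_centred_span h; rewrite linearB linearZ /= sphi1 mulr1 -EW.
by move/eqP; rewrite subr_eq0 => /eqP.
Qed.

(** Replace W r by its expectation plus a combination n of centred words.  The
    two outer words are also scalars plus such combinations, over indices
    outside P, so that all products with n have expectation 0. *)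
Lemma expect_free_run P v1 r v2 : all (predC P) (unzip1 v1) -> all P (unzip1 r) ->
  all (predC P) (unzip1 v2) -> E (v1 ++ r ++ v2) = E r * E (v1 ++ v2).
Proof.
move=> P1 Pr P2; rewrite ![in LHS]EW !mword_cat -[W r](subrK (E r *: 1)).
set n := W r - _; have hn : centred_span (all P) n := centred_span_decomp Pr.
rewrite mulrDl mulrDr linearD /= -scalerAl mul1r -scalerAr linearZ /= -mword_cat -EW.
rewrite -[RHS]add0r; congr (_ + _).
have hz : centred_span (head_sat P) (n * W v2).
  rewrite -[W v2](subrK (E v2 *: 1)) mulrDr -scalerAr mulr1; apply: centred_span_add.
    apply: (centred_span_mul (Q := predC P)) => //=; first by move=> i ->.
    apply: centred_spanW (centred_span_decomp P2) => s; exact: head_sat_all.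
  apply: centred_span_scale; apply: centred_spanW hn => s; exact: head_sat_all.
rewrite -[W v1](subrK (E v1 *: 1)) mulrDl -scalerAl mul1r linearD.
rewrite [X in _ + X]linearZ /=.
rewrite (phi_centred_span hz) mulr0 addr0.
by apply/phi_centred_span/(centred_span_mul _ (centred_span_decomp P1) hz).
Qed.

Definition usum N w : U := \sum_(v <- choices (stack N) w) W v.

Lemma usum_cat N w1 w2 : usum N (w1 ++ w2) = usum N w1 * usum N w2.
Proof.
rewrite /usum sum_choices_cat mulr_suml; apply: eq_bigr => v1 _.
by rewrite mulr_sumr; apply: eq_bigr => v2 _; rewrite mword_cat.
Qed.

Lemma phi_usum N w : ss_phi S (usum N w) = dot E N w.
Proof. by rewrite /usum linear_sum; apply: eq_bigr => v _; rewrite -EW. Qed.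

Lemma usum_eq0 N w l : l \in unzip1 w -> N l = 0%N -> usum N w = 0.
Proof. by move=> lw Nl; rewrite /usum (choices_nil lw) ?big_nil // /stack Nl. Qed.

(** Interpolates between the sum of expectations of a whole word, for rs1 empty,
    and that of a product of centred runs, for rs2 empty. *)
Definition hybrid N (rs1 rs2 : seq (seq (nat * A))) : C :=
  ss_phi S (\prod_(r <- rs1) (usum N r - dot E N r *: 1) * usum N (flatten rs2)).

Lemma hybrid_rcons N rs1 r rs2 :
  hybrid N (rcons rs1 r) rs2 = hybrid N rs1 (r :: rs2) - dot E N r * hybrid N rs1 rs2.
Proof.
rewrite /hybrid -cats1 big_cat big_seq1 /= usum_cat -mulrA mulrBl mulrBr.
by rewrite linearB -scalerAl mul1r -scalerAr linearZ.
Qed.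

Lemma hybrid_nil N rs : hybrid N [::] rs = dot E N (flatten rs).
Proof. by rewrite /hybrid big_nil mul1r phi_usum. Qed.

Lemma polyfun_hybrid p rs1 rs2 : all (gtn p) (unzip1 (flatten (rs1 ++ rs2))) ->
  polyfun p (fun N => hybrid N rs1 rs2).
Proof.
elim/last_ind: rs1 rs2 => [|rs1 r IH] rs2 h.
  by apply: eq_polyfun (polyfun_dot (expect_relabel S) h) => N; rewrite hybrid_nil.
apply: eq_polyfun (fun N => esym (hybrid_rcons N rs1 r rs2)) _.
have h' : [&& all (gtn p) (unzip1 (flatten rs1)), all (gtn p) (unzip1 r)
    & all (gtn p) (unzip1 (flatten rs2))].
  by move: h; rewrite cat_rcons flatten_cat /= /unzip1 !map_cat !all_cat.
have /and3P[h1 hr h2] := h'.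
apply: polyfunB; first by apply: IH; rewrite -cat_rcons.
have pd := polyfun_dot (expect_relabel S) hr; apply: polyfunM => //.
by apply: IH; rewrite flatten_cat /unzip1 map_cat all_cat h1.
Qed.

Lemma hybrid_vanishes rs1 rs2 l : l \in unzip1 (flatten (rs1 ++ rs2)) ->
  vanishes (fun N => hybrid N rs1 rs2) l.
Proof.
rewrite flatten_cat /unzip1 map_cat mem_cat => /orP[|] lr N Nl; last first.
  by rewrite /hybrid (usum_eq0 lr Nl) mulr0 linear0.
rewrite /hybrid (_ : \prod_(r <- rs1) _ = 0) ?mul0r ?linear0 //.
elim: rs1 lr => //= r rs1 IH; rewrite map_cat mem_cat big_cons => /orP[lr|/IH ->].
  by rewrite (usum_eq0 lr Nl) (dot_vanishes E lr Nl) scale0r subr0 mul0r.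
by rewrite mulr0.
Qed.

(** Uncentring the run r adds dot r times a hybrid of the other runs, and the
    label of r occurs in both factors. *)
Lemma mlcoef_hybrid p L rs1 rs2 :
  all (gtn p) (unzip1 (flatten (rs1 ++ rs2))) ->
  (forall rs r rs', rs1 ++ rs2 = rs ++ r :: rs' ->
     exists2 l, l \in unzip1 r & l \in unzip1 (flatten (rs ++ rs'))) ->
  mlcoef p L (fun N => hybrid N rs1 rs2) =
  mlcoef p L (fun N => dot E N (flatten (rs1 ++ rs2))).
Proof.
elim/last_ind: rs1 rs2 => [|rs1 r IH] rs2 h two.
  apply: eq_mlcoef; first exact: polyfun_hybrid.
  by move=> N; rewrite hybrid_nil.
rewrite !cat_rcons in h two *; have [l lr l12] := two _ _ _ erefl.
have sub : {subset unzip1 r <= unzip1 (flatten (rs1 ++ r :: rs2))}.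
  by move=> k kr; rewrite flatten_cat /= /unzip1 !map_cat !mem_cat kr orbT.
have hr : all (gtn p) (unzip1 r) by apply/allP => k /sub; exact: allP.
have h12 : all (gtn p) (unzip1 (flatten (rs1 ++ rs2))).
  move: h; rewrite !flatten_cat /= /unzip1 !map_cat !all_cat => /and3P[-> _ ->] //.
rewrite -IH // (eq_mlcoef _ _ (fun N => hybrid_rcons N rs1 r rs2)); last first.
  by apply: polyfun_hybrid; rewrite cat_rcons.
have pd := polyfun_dot (expect_relabel S) hr.
rewrite mlcoefB; [|exact: polyfun_hybrid|by apply: polyfunM => //; exact: polyfun_hybrid].
rewrite (mlcoefM_common L (b := l)) ?subr0 //.
- by move/allP: hr => /(_ l lr).
- exact: polyfun_hybrid.
- exact: dot_vanishes.
- exact: hybrid_vanishes.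
Qed.

(** Centred elements of neighbouring runs live over disjoint sets of copies. *)
Lemma hybrid_alternating N (rs : seq (nat * seq (nat * A))) : rs != [::] ->
  alternating rs -> (forall q, q \in rs -> all (pred1 q.1) (unzip1 q.2)) ->
  hybrid N [seq q.2 | q <- rs] [::] = 0.
Proof.
case: rs => // -[l r] rs _; rewrite /hybrid {2}/usum big_seq1 /mword big_nil mulr1.
move=> alt const; apply: (@phi_centred_span (head_sat (mem (stack N l)))).
have run q : q \in (l, r) :: rs ->
    centred_span (all (mem (stack N q.1))) (usum N q.2 - dot E N q.2 *: 1).
  move=> /const qc; rewrite /usum /dot scaler_suml -sumrB big_seq.
  apply: big_ind => [||v vI]; [exact: centred_span0 | exact: centred_span_add |].
  apply: centred_span_decomp.
  by apply: (choices_all (P := pred1 q.1)) vI => // k j /eqP ->.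
elim: rs l r alt {const} run => [|[k r'] rs IH] l r alt run.
  rewrite /= big_seq1; apply: centred_spanW (run _ (mem_head _ _)) => s; exact: head_sat_all.
rewrite map_cons big_cons; apply: centred_span_mul (run _ (mem_head _ _)) _; last first.
  apply: IH => [|q qrs]; first by move: alt => /andP[].
  by apply: run; rewrite inE qrs orbT.
move: alt => /andP[/= lk _] i /=; apply: contraTN => ik; apply: contra lk => il.
by rewrite (stack_inj il ik).
Qed.

Lemma run_decomposition w : exists rs : seq (nat * seq (nat * A)),
  [/\ flatten [seq q.2 | q <- rs] = w, alternating rs &
     forall q, q \in rs -> q.2 != [::] /\ all (pred1 q.1) (unzip1 q.2)].
Proof.
elim: w => [|[l x] w [rs [<- alt rsE]]]; first by exists [::].
case: rs alt rsE => [|[k r] rs] alt rsE.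
  exists [:: (l, [:: (l, x)])]; split=> // q; rewrite inE => /eqP -> /=.
  by rewrite eqxx.
have [lk|lk] := eqVneq l k.
  subst k; exists ((l, (l, x) :: r) :: rs); split=> //; first by case: (rs) alt.
  move=> q; rewrite inE => /predU1P[->|qrs].
    by have [_ /= ->] := rsE _ (mem_head _ _); rewrite eqxx.
  by apply: rsE; rewrite inE qrs orbT.
exists [:: (l, [:: (l, x)]), (k, r) & rs]; split=> //.
  by move: alt; rewrite /alternating /= lk.
by move=> q; rewrite inE => /predU1P[->|]; [rewrite /= eqxx | exact: rsE].
Qed.

(** If some label occurs in a single run, that run is peeled off.  Otherwise
    every run shares its label with another one, and [mlcoef_hybrid] compares
    the word with a completely centred product. *)
Theorem free_wcum p w : all (gtn p) (unzip1 w) ->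
  (noncrossing_seq (unzip1 w) -> wcum E p w = block_wcum E p w) /\
  (~ noncrossing_seq (unzip1 w) -> wcum E p w = 0).
Proof.
apply: wcum_factorization => //; first exact: expect_relabel.
move=> {}w w0 wp; set s := unzip1 w.
have s0 : s != [::] by rewrite /s; case: (w) w0.
(* Labels with a single run. *)
pose contiguous l := all (fun y => (y == l) || ~~ subseq [:: l; y; l] s) s.
have contP l : (forall y, y != l -> ~~ subseq [:: l; y; l] s) -> contiguous l.
  by move=> H; apply/allP => y _; case: eqP => //= /eqP/H.
have [/hasP[l ls lc]|nohas] := boolP (has contiguous s); [left|right].
  have [m [s1 [s2 [wE ls1 hs2]]]] := first_run ls.
  have ls2 : l \notin s2.
    apply/negP => ls2; have [y [ys yl sub]] := return_of_run m s1 ls2 hs2.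
    have ys' : y \in s by rewrite wE !mem_cat ys !orbT.
    by have := allP lc _ ys'; rewrite (negPf yl) /= wE sub.
  have [w1 [t [wE1 w1E tE]]] := unzip1_cat wE.
  have [r [w2 [tE' rE w2E]]] := unzip1_cat tE.
  subst t w; have sr : size r = m.+1 by rewrite -(size_map fst) -/(unzip1 r) rE size_nseq.
  apply: (@peelable_run _ _ _ _ _ _ _ l) => //.
  - by rewrite sr.
  - by rewrite rE sr.
  - by rewrite w1E.
  - by rewrite w2E.
  - move=> N; apply: dot_run => v1 vr v2 v1I vrI v2I.
    have off v u : l \notin unzip1 u -> v \in choices (stack N) u ->
        all (predC (mem (stack N l))) (unzip1 v).
      move=> lu; apply: (choices_all (P := predC1 l)) => [k j kl jk|] /=.
        by apply: contra kl => /(stack_inj jk) ->.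
      by apply/allP => k ku /=; apply: contraNneq lu => <-.
    apply: (@expect_free_run (mem (stack N l))).
    + by apply: off v1I; rewrite w1E.
    + apply: (choices_all (P := pred1 l)) vrI => [k j /eqP -> //|].
      by rewrite rE all_nseq /= eqxx.
    + by apply: off v2I; rewrite w2E.
  - by rewrite rE w2E w1E; exact: noncrossing_seq_peel.
split; last first.
  move=> nc; have [l ls lc] := noncrossing_contiguous s0 nc.
  by case/hasP: nohas; exists l => //; exact: contP.
have [rs [rsw alt rsE]] := run_decomposition w.
rewrite /wcum -{2}rsw -[[seq q.2 | q <- rs]]cats0 -mlcoef_hybrid.
- apply: mlcoef0 => N; apply: hybrid_alternating => // [|q /rsE[]//].
  by apply: contraNneq w0 => rs0; rewrite -rsw rs0.
- by rewrite cats0 rsw.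
rewrite cats0 => rs1 r rs2 rsE'.
have /mapP[[l r'] q_rs /= rr'] : r \in [seq q.2 | q <- rs].
  by rewrite rsE' mem_cat mem_head orbT.
subst r'; have [/= r0 rl] := rsE _ q_rs.
have rN : unzip1 r = nseq (size r) l.
  by have /all_pred1P := rl; rewrite size_map.
exists l; first by rewrite rN mem_nseq eqxx andbT lt0n size_eq0.
apply: contraNT nohas; rewrite flatten_cat /unzip1 map_cat mem_cat negb_or => /andP[l1 l2].
have sE : s = unzip1 (flatten rs1) ++ nseq (size r) l ++ unzip1 (flatten rs2).
  by rewrite /s -rsw rsE' flatten_cat /= /unzip1 !map_cat -rN.
apply/hasP; exists l; first by rewrite sE !mem_cat mem_nseq lt0n size_eq0 r0 eqxx orbT.
by apply: contP => y yl; rewrite sE; exact: no_return.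
Qed.

End Free.

(** * Classes of ordered set partitions *)

Section PartitionClasses.
Local Open Scope nat_scope.
Variable n : nat.
Implicit Types (rho : osp n) (B : {set 'I_n}).

Definition block_labels rho : seq nat := [seq block_index rho k | k <- enum 'I_n].

Lemma enum_ord_sorted : sorted (relpre val ltn) (enum 'I_n).
Proof. by rewrite -sorted_map val_enum_ord iota_ltn_sorted. Qed.

Lemma subseq_labelsP rho t :
  reflect (exists2 ks : seq 'I_n, sorted (relpre val ltn) ks &
             map (block_index rho) ks = t)
    (subseq t (block_labels rho)).
Proof.
have tr : transitive (relpre (val : 'I_n -> nat) ltn) by move=> i j k; exact: ltn_trans.
apply: (iffP subseqP) => [[m sm ->]|[ks kss <-]].
  exists (mask m (enum 'I_n)); last by rewrite map_mask.
  by apply: subseq_sorted (mask_subseq _ _) enum_ord_sorted.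
apply/subseqP; apply: map_subseq.
have -> : ks = [seq k <- enum 'I_n | k \in ks]; last exact: filter_subseq.
apply: (irr_sorted_eq tr) => //.
- by move=> k; rewrite /= ltnn.
- by apply: subseq_sorted (filter_subseq _ _) enum_ord_sorted.
- by move=> k; rewrite mem_filter mem_enum andbT.
Qed.

Lemma mem_block rho B k : B \in blocks rho ->
  (k \in B) = (block_index rho k == index B (blocks rho)).
Proof. by move=> Br; rewrite block_index_nth ?index_mem // nth_index. Qed.

Lemma block_of rho k :
  exists2 B, B \in blocks rho & index B (blocks rho) = block_index rho k.
Proof.
have [B Br kB] := osp_cover rho k; exists B => //.
by apply/esym/eqP; rewrite -mem_block.
Qed.

Lemma interval_ospP rho : interval_osp rho <-> interval_seq (block_labels rho).
Proof.
split=> [int x y /subseq_labelsP[[|i [|j [|k []]]] //=]|int B Br i j k iB kB /andP[ij jk]].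
  rewrite andbT => /andP[ij jk] [ix jy kx].
  have [B Br BE] := block_of rho i.
  have : j \in B.
    by apply: (int B Br i j k); rewrite ?ij // (mem_block _ Br) BE ?ix ?kx.
  by rewrite (mem_block _ Br) BE ix jy => /eqP.
have e1 := iB; have e2 := kB.
rewrite (mem_block i Br) in e1; rewrite (mem_block k Br) in e2.
rewrite (mem_block j Br) -(eqP e1); apply/eqP/esym/int/subseq_labelsP.
by exists [:: i; j; k]; rewrite /= ?ij ?jk // (eqP e1) (eqP e2).
Qed.

Lemma noncrossing_ospP rho : noncrossing rho <-> noncrossing_seq (block_labels rho).
Proof.
split=> nc => [x y /subseq_labelsP[[|i [|j [|k [|l []]]]] //=]|].
  rewrite andbT => /and3P[ij jk kl] [ix jy kx ly].
  apply/eqP; apply: contraT => xy; case: nc.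
  have [B Br BE] := block_of rho i; have [B' Br' BE'] := block_of rho j.
  exists B, B', i, j, k, l; rewrite !(mem_block _ Br, mem_block _ Br') BE BE' ix jy kx ly !eqxx.
  by split=> //; split=> //; apply: contraNneq xy => BB; rewrite -ix -jy -BE -BE' BB.
case=> B [B' [i [j [k [l [[Br Br' BB'] [[ij jk kl] []]]]]]]].
rewrite !(mem_block _ Br, mem_block _ Br') => /eqP iB /eqP kB /eqP jB /eqP lB; case/eqP: BB'.
rewrite -(nth_index set0 Br) -(nth_index set0 Br'); congr nth; apply: nc.
apply/subseq_labelsP; exists [:: i; j; k; l]; rewrite /= ?ij ?jk ?kl //.
by rewrite iB jB kB lB.
Qed.

(** A pattern x y x means that the block x surrounds at least one element of
    the block y; in the absence of crossings it then surrounds all of them. *)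
Lemma monotone_ospP rho : monotone_osp rho <-> monotone_seq (block_labels rho).
Proof.
split=> [[/noncrossing_ospP nc mon] x y sub|mon].
  have [->//|xy] := eqVneq x y; apply: ltnW.
  have /subseq_labelsP[[|i [|j [|k []]]] //=] := sub.
  rewrite andbT => /andP[ij jk] [ix jy kx].
  have [B Br BE] := block_of rho i; have [B' Br' BE'] := block_of rho j.
  rewrite -ix -jy -BE -BE'; apply: mon => //; exists i, k; split.
  - by rewrite (mem_block _ Br) BE.
  - by rewrite (mem_block _ Br) BE ix kx.
  move=> l; rewrite (mem_block _ Br') BE' jy => /eqP ly.
  (* An element l of the block y outside the interval from i to k would give a
   crossing. *)
  have ci (a b c d : 'I_n) : a < b -> b < c -> c < d -> block_index rho a = block_index rho c ->
      block_index rho b = block_index rho d -> block_index rho a = block_index rho b.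
    move=> ab bc cd ac bd; apply: nc; apply/subseq_labelsP; exists [:: a; b; c; d].
      by rewrite /= ab bc cd.
    by rewrite /= -ac -bd.
  have il : i != l by apply: contraNneq xy => il; rewrite -ix -ly il.
  have kl : k != l by apply: contraNneq xy => kl; rewrite -kx -ly kl.
  apply/andP; split; rewrite ltn_neqAle ?il // ?[l == k :> nat]eq_sym ?kl /=.
    rewrite leqNgt; apply: contra xy => li.
    by have := ci l i j k li ij jk; rewrite ix jy kx ly => ->.
  rewrite leqNgt; apply: contra xy => kl'.
  by have := ci i j k l ij jk kl'; rewrite ix jy kx ly => ->.
split.
  apply/noncrossing_ospP => x y sub; apply/eqP; rewrite eqn_leq; apply/andP; split; apply: mon.
    by apply: subseq_trans sub; exact: (prefix_subseq [:: x; y; x] [:: y]).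
  by apply: subseq_trans sub; exact: subseq_cons.
move=> B B' Br Br' [i [k [iB kB inn]]].
have /set0Pn[j jB'] := osp_neq0 Br'; have /andP[ij jk] := inn j jB'.
move: (iB) (kB) (jB'); rewrite !(mem_block _ Br, mem_block _ Br') => /eqP iE /eqP kE /eqP jE.
have le : index B (blocks rho) <= index B' (blocks rho).
  apply: mon; apply/subseq_labelsP; exists [:: i; j; k]; rewrite /= ?ij ?jk //.
  by rewrite iE jE kE.
rewrite ltn_neqAle le andbT; apply/eqP => BB'.
have iB' : i \in B' by rewrite (mem_block _ Br') iE BB'.
by have := inn i iB'; rewrite ltnn.
Qed.

End PartitionClasses.

Lemma unzip1_labelled (A : Type) n (rho : osp n) (X : 'I_n -> A) :
  unzip1 (labelled (block_index rho) X) = block_labels rho.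
Proof. by rewrite /unzip1 /labelled -map_comp. Qed.

Theorem proposition3p24 (R : realType) :
  (forall (A : algType R[i]) (phi : {scalar A}), phi 1 = 1 ->
     (forall (U : algType R[i]) (S : spreadability_system U phi),
        tensor_system S ->
        forall (n : nat) (pi : osp n) (X : 'I_n -> A), (0 < n)%N ->
          cumulant S pi X = block_cumulant S pi X) /\
     (forall (U : algType R[i]) (S : spreadability_system U phi),
        free_system S ->
        forall (n : nat) (pi : osp n) (X : 'I_n -> A), (0 < n)%N ->
          (noncrossing pi -> cumulant S pi X = block_cumulant S pi X) /\
          (~ noncrossing pi -> cumulant S pi X = 0))) /\
  (forall (A : nuAlgType R[i]) (phi : {scalar A}),
     (forall (U : nuAlgType R[i]) (S : spreadability_system U phi),
        boolean_system S ->
        forall (n : nat) (pi : osp n) (X : 'I_n -> A), (0 < n)%N ->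
          (interval_osp pi -> cumulant S pi X = block_cumulant S pi X) /\
          (~ interval_osp pi -> cumulant S pi X = 0)) /\
     (forall (U : nuAlgType R[i]) (S : spreadability_system U phi),
        monotone_system S ->
        forall (n : nat) (pi : osp n) (X : 'I_n -> A), (0 < n)%N ->
          (monotone_osp pi -> cumulant S pi X = block_cumulant S pi X) /\
          (~ monotone_osp pi -> cumulant S pi X = 0))).
Proof.
split=> [A phi phi1|A phi]; split=> U S sys n pi X n0.
- by rewrite cumulant_wcum // block_cumulant_wcum tensor_wcum //; exact: labelled_lt.
- have := free_wcum phi1 sys (labelled_lt pi X).
  rewrite cumulant_wcum // block_cumulant_wcum unzip1_labelled => -[eqc eq0].
  by split=> [/noncrossing_ospP|nc]; [exact: eqc | apply: eq0 => /noncrossing_ospP].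
- have := boolean_wcum sys (labelled_lt pi X).
  rewrite cumulant_wcum // block_cumulant_wcum unzip1_labelled => -[eqc eq0].
  by split=> [/interval_ospP|nc]; [exact: eqc | apply: eq0 => /interval_ospP].
- have := monotone_wcum sys (labelled_lt pi X).
  rewrite cumulant_wcum // block_cumulant_wcum unzip1_labelled => -[eqc eq0].
  by split=> [/monotone_ospP|nc]; [exact: eqc | apply: eq0 => /monotone_ospP].
Qed.
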